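(* Let $\Omega\subseteq\mathbb C^m$ be a bounded domain, $m\ge1$, let $\boldsymbol T=(T_1,\ldots,T_m)\in\mathrm B_1(\Omega)$, and let $\gamma$ be a non-vanishing holomorphic map from $\Omega$ into the Hilbert space $\mathcal H$ on which $\boldsymbol T$ acts, with $\gamma(w)\in\bigcap_{k=1}^m\ker(T_k-w_kI)$ for $w\in\Omega$. For $w\in\Omega$ and $1\le k\le m$, let $\left(\begin{smallmatrix}0&\boldsymbol\alpha_k(w)^{\rm t}\\0&\boldsymbol 0\end{smallmatrix}\right)$ be the matrix of $N_k(w)=(T_k-w_kI)|_{\mathcal N(w)}$ with respect to an orthonormal basis of $\mathcal N(w)$ whose first vector is a scalar multiple of $\gamma(w)$, and let $A(w)$ be the $m\times m$ matrix whose $k$-th column is $\boldsymbol\alpha_k(w)$. Then $$\big(-\mathcal K_{\boldsymbol T}(w)^{\rm t}\big)^{-1}=\Big(\operatorname{tr}\big(N_k(w)N_j(w)^*\big)\Big)_{k,j=1}^m=A(w)^{\rm t}\,\overline{A(w)} .$$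
   Context: $\mathrm B_1(\Omega)$ is the class of $m$-tuples $\boldsymbol T=(T_1,\ldots,T_m)$ of commuting bounded operators on a Hilbert space $\mathcal H$ such that: (1) $\dim\bigcap_{k=1}^m\ker(T_k-w_kI)=1$ for every $w\in\Omega$; (2) for every $w\in\Omega$ the operator $h\mapsto((T_1-w_1I)h,\ldots,(T_m-w_mI)h)$ from $\mathcal H$ to $\mathcal H\oplus\cdots\oplus\mathcal H$ has closed range; (3) the closed linear span of $\bigcup_{w\in\Omega}\bigcap_{k=1}^m\ker(T_k-w_kI)$ is $\mathcal H$. A holomorphic choice $\gamma$ of joint eigenvectors exists locally (Cowen-Douglas), and $\Omega$ is replaced by an open subset on which it exists. The subspace $\mathcal N(w):=\bigcap_{i,j=1}^m\ker(T_i-w_iI)(T_j-w_jI)$ is $(m+1)$-dimensional, spanned by $\gamma(w),(\partial_1\gamma)(w),\ldots,(\partial_m\gamma)(w)$. The curvature matrix is $\mathcal K_{\boldsymbol T}(w)=-\Big(\frac{\partial^2}{\partial w_i\partial\bar w_j}\log\|\gamma(w)\|^2\Big)_{i,j=1}^m$. The superscript ${\rm t}$ denotes transpose and the bar entrywise complex conjugation. *)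

(* Defs.v *)
From HB Require Import structures.
From mathcomp Require Import all_boot all_order all_algebra complex.
From mathcomp Require Import all_classical all_reals all_analysis.

Set Implicit Arguments.
Unset Strict Implicit.
Unset Printing Implicit Defensive.

Import Order.TTheory GRing.Theory Num.Theory.
Import numFieldNormedType.Exports.

Local Open Scope classical_set_scope.
Local Open Scope complex_scope.
Local Open Scope ring_scope.

(* The topology and norm that [R[i]] carries as a numerical field, made available
   on the type [R[i]] itself. *)
HB.instance Definition _ (R : rcfType) := PseudoPointedMetric.copy R[i] R[i]^o.
HB.instance Definition _ (R : rcfType) := GRing.ComAlgebra.copy R[i] R[i]^o.
HB.instance Definition _ (R : rcfType) := Vector.copy R[i] R[i]^o.
HB.instance Definition _ (R : rcfType) := NormedModule.copy R[i] R[i]^o.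

Section linear_algebra.
Variables (C : numClosedFieldType) (H : normedModType C).

Definition linear_span (S : set H) : set H :=
  [set x | exists n (c : 'I_n -> C) (v : 'I_n -> H),
     (forall i, S (v i)) /\ x = \sum_i c i *: v i].

Definition is_basis n (V : set H) (b : 'I_n -> H) : Prop :=
  (forall c : 'I_n -> C, \sum_i c i *: b i = 0 -> forall i, c i = 0) /\
  V = [set x | exists c : 'I_n -> C, x = \sum_i c i *: b i].

Definition has_dim (V : set H) (n : nat) : Prop :=
  exists b : 'I_n -> H, is_basis V b.

Definition orthonormal_basis (dot : {dot H for Num.conj}) n (V : set H)
    (e : 'I_n -> H) : Prop :=
  is_basis V e /\ forall i j, dot (e i) (e j) = (i == j)%:R.

(* Column convention: the j-th column of [M] lists the coordinates of
   [f (b j)]. *)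
Definition is_matrix n (b : 'I_n -> H) (f : H -> H) (M : 'M[C]_n) : Prop :=
  forall j, f (b j) = \sum_i M i j *: b i.

(* Trace of an endomorphism [f] of a finite-dimensional subspace [V]; the values
   of [f] outside [V] play no role. *)
Definition trace_on (V : set H) (f : H -> H) : C :=
  xget 0 [set t | exists n (b : 'I_n -> H) (M : 'M[C]_n),
     [/\ is_basis V b, is_matrix b f M & t = \tr M]].

(* Adjoint of an endomorphism [f] of a finite-dimensional subspace [V], for the
   inner product that [V] inherits from [H], extended by [0] outside [V]. *)
Definition adjoint_on (dot : {dot H for Num.conj}) (V : set H) (f : H -> H) :
    H -> H :=
  xget (fun=> 0) [set g : H -> H |
     [/\ forall y, V y -> V (g y),
         forall y, ~ V y -> g y = 0 &
         forall x y, V x -> V y -> dot (f x) y = dot x (g y)]].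

End linear_algebra.

Section wirtinger.
Variables (R : realType) (m : nat).
Local Notation C := R[i].
Implicit Types (f : 'rV[C]_m -> C) (w v : 'rV[C]_m).

(* Derivative at [t = 0] of [f (w + t v)], for a *real* variable [t]. *)
Definition real_derive f v w : C :=
  derive1 (fun t : R => complex.Re (f (w + t%:C *: v))) 0 +i*
  derive1 (fun t : R => complex.Im (f (w + t%:C *: v))) 0.

(* [d/dw_k = (d/dx_k - i d/dy_k) / 2] and [d/dwbar_k = (d/dx_k + i d/dy_k) / 2],
   where [w_k = x_k + i y_k]. *)
Definition dw (k : 'I_m) f w : C :=
  2^-1 * (real_derive f (delta_mx 0 k) w
          - 'i%C * real_derive f ('i%C *: delta_mx 0 k) w).

Definition dwbar (k : 'I_m) f w : C :=
  2^-1 * (real_derive f (delta_mx 0 k) w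
          + 'i%C * real_derive f ('i%C *: delta_mx 0 k) w).

Definition log_sqnorm (H : normedModType C) (gamma : 'rV[C]_m -> H) w : C :=
  (ln (complex.Re (`|gamma w| ^+ 2)))%:C.

Definition curvature (H : normedModType C) (gamma : 'rV[C]_m -> H) w : 'M[C]_m :=
  - \matrix_(i, j) dw i (dwbar j (log_sqnorm gamma)) w.

End wirtinger.

Section cowen_douglas.
Variables (R : realType) (m : nat).
Local Notation C := R[i].

Definition bounded_domain (Omega : set 'rV[C]_m) : Prop :=
  [/\ open Omega, connected Omega, Omega !=set0 & bounded_set Omega].

Definition holomorphic_on (H : normedModType C) (Omega : set 'rV[C]_m)
    (gamma : 'rV[C]_m -> H) : Prop :=
  forall w, Omega w -> differentiable gamma w.

Variable H : normedModType C.
Implicit Types (T : 'I_m -> {linear H -> H}) (w : 'rV[C]_m).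

(* [T_k - w_k I]; its restriction to [second_ker T w] is [N_k(w)]. *)
Definition shift_op T w (k : 'I_m) (h : H) : H := T k h - w 0 k *: h.

Definition joint_ker T w : set H := [set h | forall k, shift_op T w k h = 0].

(* The space [\mathcal N(w)]. *)
Definition second_ker T w : set H :=
  [set h | forall i j, shift_op T w i (shift_op T w j h) = 0].

(* The direct sum [H + ... + H] of [m] copies of [H] carries the product
   topology, which is that of its Hilbert norm. *)
Record B1 (Omega : set 'rV[C]_m) T : Prop := {
  B1_bounded : forall k, exists M : R, forall h, `|T k h| <= M%:C * `|h| ;
  B1_commute : forall i j h, T i (T j h) = T j (T i h) ;
  B1_dim : forall w, Omega w -> has_dim (joint_ker T w) 1 ;
  B1_closed_range : forall w, Omega w ->
    closed (range (fun h k => shift_op T w k h)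
            : set (prod_topology (fun _ : 'I_m => H))) ;
  B1_span : closure (linear_span (\bigcup_(w in Omega) joint_ker T w)) = setT
}.

End cowen_douglas.

(* Main.v *)
Require Import Defs.
From HB Require Import structures.
From mathcomp Require Import all_boot all_order all_algebra complex.
From mathcomp Require Import all_classical all_reals all_analysis.
From mathcomp Require Import ring lra.
Set Implicit Arguments.
Unset Strict Implicit.
Unset Printing Implicit Defensive.
Import Order.TTheory GRing.Theory Num.Theory.
Import numFieldNormedType.Exports.
Local Open Scope classical_set_scope.
Local Open Scope complex_scope.
Local Open Scope ring_scope.

(* Write [D_k] for the derivative of [gamma] at [w] along the [k]-th axis and [N] for
   the square norm of [gamma w]. Differentiating [(T_j - w_j) gamma = 0] gives
   [(T_j - w_j) D_k = delta_jk gamma], so that [D_k] lies in the second kernel; in the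
   orthonormal basis [e] its coordinates along [e_1, ..., e_m] form the [k]-th column
   of a matrix [B] with [A^T B = c^-1 1], where [e_0 = c gamma]. On the other hand
   [- K_ij = <D_i, D_j> / N - <D_i, gamma> <gamma, D_j> / N^2], which is the Gram
   matrix of the components of the [D_k] orthogonal to [gamma], divided by [N]; hence
   [- K^T] is [|c|^2 B^* B], the inverse of [A^T conj(A)].
   The operators [N_k N_j^*] have rank one on the second kernel, with range spanned
   by [e_0], so their traces are read off from the image of [e_0].

   The curvature involves second derivatives of a map that is only assumed to be
   complex differentiable. Their existence rests on Goursat's theorem: the mean value
   property, read in logarithmic coordinates, expresses first derivatives as integrals
   over circles, which are differentiated under the integral sign. This is done for
   the scalar functions [<gamma, h>]; the Cauchy estimate, with [h] the derivative
   itself, bounds the derivatives of [gamma] in norm, and this suffices to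
   differentiate the products [<D_j, gamma>]. *)

(** * Goursat's theorem for real closed forms *)

Section green.
Variable R : realType.
Local Notation mu := (@lebesgue_measure R).
Local Notation intg a b f := (\int[mu]_(x in `[a, b]) f x).

Lemma continuous_itv_integrable (f : R -> R) a b :
  {in `[a, b], continuous f} -> mu.-integrable `[a, b] (EFin \o f).
Proof.
move=> cf; apply: continuous_compact_integrable; first exact: segment_compact.
by apply: continuous_in_subspaceT => x /set_mem; exact: cf.
Qed.

Lemma Rintegral_chasles (f : R -> R) a b c : a <= b -> b <= c ->
  {in `[a, c], continuous f} -> intg a c f = intg a b f + intg b c f.
Proof.
move=> ab bc cf; apply/eqP; rewrite addrC -subr_eq; apply/eqP.
rewrite Rintegral_itvB ?bnd_simp//; last exact: continuous_itv_integrable.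
rewrite Rintegral_itv_obnd_cbnd//.
apply: integrableS (continuous_itv_integrable cf) => //.
by apply: subset_itv; rewrite bnd_simp.
Qed.

Lemma Rintegral_itv_cst a b (k : R) : a <= b ->
  \int[mu]_(x in `[a, b]) k = k * (b - a).
Proof.
move=> ab; rewrite Rintegral_cst//= lebesgue_measure_itv/= lte_fin.
by case: ltgtP ab => // -> _; rewrite subrr.
Qed.

Lemma le_norm_Rintegral_itv (f : R -> R) a b e : a <= b ->
  {in `[a, b], continuous f} -> (forall x, x \in `[a, b] -> `|f x| <= e) ->
  `|intg a b f| <= e * (b - a).
Proof.
move=> ab cf fe; have intf := continuous_itv_integrable cf.
have intc k : mu.-integrable `[a, b] (EFin \o cst k).
  by apply: continuous_itv_integrable => x _; exact: cvg_cst.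
rewrite ler_norml -mulNr -!Rintegral_itv_cst//; apply/andP; split.
  by apply: le_Rintegral => // [|x /fe]; [exact: intc | rewrite ler_norml => /andP[]].
by apply: le_Rintegral => // [|x /fe]; [exact: intc | rewrite ler_norml => /andP[]].
Qed.

Lemma Rintegral_itv_near_cst (f : R -> R) a b k e : a <= b ->
  {in `[a, b], continuous f} -> (forall x, x \in `[a, b] -> `|f x - k| <= e) ->
  `|intg a b f - k * (b - a)| <= e * (b - a).
Proof.
move=> ab cf fe.
have intc : mu.-integrable `[a, b] (EFin \o cst k).
  by apply: continuous_itv_integrable => x _; exact: cvg_cst.
rewrite -Rintegral_itv_cst// -RintegralB//; last exact: continuous_itv_integrable.
apply: le_norm_Rintegral_itv => // x xab.
by apply: cvgB; [exact: cf | exact: cvg_cst].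
Qed.

(* [P dx + Q dy] is differentiable at [(x, y)] and closed there. *)
Definition closed_form_at (P Q : R -> R -> R) x y := exists p k q, forall e, 0 < e ->
  exists2 d, 0 < d & forall h1 h2, `|h1| < d -> `|h2| < d ->
  `|P (x + h1) (y + h2) - P x y - (p * h1 + k * h2)| <= e * (`|h1| + `|h2|) /\
  `|Q (x + h1) (y + h2) - Q x y - (k * h1 + q * h2)| <= e * (`|h1| + `|h2|).


Lemma lipschitz_at_continuous (f : R -> R) x d M : 0 < d -> 0 < M ->
  (forall h, `|h| < d -> `|f (x + h) - f x| <= M * `|h|) ->
  {for x, continuous f}.
Proof.
move=> d0 M0 H; apply/cvgrPdist_le => e e0; apply/nbhs_ballP.
exists (Num.min d (e / M)) => /=; first by rewrite lt_min d0 divr_gt0.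
move=> z; rewrite /ball/= lt_min => /andP[]; rewrite distrC => zd ze.
have := H (z - x) zd; rewrite (addrC x) subrK [`|f x - _|]distrC => /le_trans; apply.
by rewrite mulrC -ler_pdivlMr// ltW.
Qed.

Variables P Q : R -> R -> R.

(** Taking [e = 1] in the differentiability condition gives a Lipschitz bound at the point along
    each axis. *)
Lemma closed_form_continuous x y : closed_form_at P Q x y ->
  {for x, continuous (P ^~ y)} /\ {for y, continuous (Q x)}.
Proof.
move=> [p [k [q /(_ 1 ltr01)[d d0 H]]]]; have z0 : `|0 : R| < d by rewrite normr0.
split.
  apply: (@lipschitz_at_continuous _ _ d (1 + `|p|)); rewrite ?ltr_wpDr//.
  move=> h hd; have [+ _] := H h 0 hd z0.
  rewrite normr0 !addr0 mulr0 addr0 mul1r => H1.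
  rewrite -[X in `|X|](subrK (p * h)) (le_trans (ler_normD _ _))//.
  by rewrite mulrDl mul1r normrM lerD.
apply: (@lipschitz_at_continuous _ _ d (1 + `|q|)); rewrite ?ltr_wpDr//.
move=> h hd; have [_ +] := H 0 h z0 hd.
rewrite normr0 !addr0 mulr0 add0r mul1r add0r => H1.
rewrite -[X in `|X|](subrK (q * h)) (le_trans (ler_normD _ _))//.
by rewrite mulrDl mul1r normrM lerD.
Qed.

(** The integral of [P dx + Q dy] along the counterclockwise boundary of the rectangle with lower
    left corner [(x, y)] and sides [l], [m]. *)
Definition boundary x y l m :=
  intg x (x + l) (P ^~ y) - intg x (x + l) (P ^~ (y + m)) +
  intg y (y + m) (Q (x + l)) - intg y (y + m) (Q x).

Definition closed_form_on x y l m := forall x' y',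
  x' \in `[x, x + l] -> y' \in `[y, y + m] -> closed_form_at P Q x' y'.

(** Each inner side of the four quarters is traversed twice, in opposite directions. *)
Lemma boundary_split x y l m : 0 <= l -> 0 <= m ->
  closed_form_on x y (l + l) (m + m) ->
  boundary x y (l + l) (m + m) =
  boundary x y l m + boundary (x + l) y l m + boundary x (y + m) l m +
  boundary (x + l) (y + m) l m.
Proof.
move=> l0 m0 D.
have splP y' : y' \in `[y, y + (m + m)] ->
    intg x (x + (l + l)) (P ^~ y') =
    intg x (x + l) (P ^~ y') + intg (x + l) (x + l + l) (P ^~ y').
  move=> yy; rewrite addrA; apply: Rintegral_chasles; rewrite ?lerDl//.
  by move=> x' xx; apply: (closed_form_continuous (D _ _ _ yy)).1; rewrite addrA.
have splQ x' : x' \in `[x, x + (l + l)] ->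
    intg y (y + (m + m)) (Q x') =
    intg y (y + m) (Q x') + intg (y + m) (y + m + m) (Q x').
  move=> yy; rewrite addrA; apply: Rintegral_chasles; rewrite ?lerDl//.
  by move=> y' xx; apply: (closed_form_continuous (D _ _ yy _)).2; rewrite addrA.
rewrite /boundary !splP ?splQ ?in_itv/= ?lexx ?lerDl ?addr_ge0//.
rewrite !addrA.
move: (intg _ _ _) => a1; move: (intg _ _ _) => a2.
by ring.
Qed.

(** Expand [P] and [Q] to first order at [(x0, y0)]. Opposite sides cancel the constants and the
    terms in [p] and [q]; the contributions [- k m l] and [k l m] of the shared coefficient [k]
    cancel by closedness. Only the error terms survive. *)
Lemma boundary_small x y l m x0 y0 p k q e d : 0 < l -> 0 < m -> 
  x0 \in `[x, x + l] -> y0 \in `[y, y + m] -> l < d -> m < d -> 0 <= e ->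
  closed_form_on x y l m ->
  (forall h1 h2, `|h1| < d -> `|h2| < d ->
  `|P (x0 + h1) (y0 + h2) - P x0 y0 - (p * h1 + k * h2)| <= e * (`|h1| + `|h2|) /\
  `|Q (x0 + h1) (y0 + h2) - Q x0 y0 - (k * h1 + q * h2)| <= e * (`|h1| + `|h2|)) ->
  `|boundary x y l m| <= 2 * e * (l + m) ^+ 2.
Proof.
move=> l0 m0 xx0 yy0 ld md e0 D H.
have itv_dist (s t n : R) (z : R) : s \in `[t, t + n] -> z \in `[t, t + n] -> `|z - s| <= n.
  by rewrite !in_itv/= ler_norml => /andP[? ?] /andP[? ?]; apply/andP; split; lra.
have bx x' := itv_dist _ _ _ x' xx0; have by' y' := itv_dist _ _ _ y' yy0.
have H' x' y' : x' \in `[x, x + l] -> y' \in `[y, y + m] -> 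
  `|P x' y' - P x0 y0 - (p * (x' - x0) + k * (y' - y0))| <= e * (l + m) /\
  `|Q x' y' - Q x0 y0 - (k * (x' - x0) + q * (y' - y0))| <= e * (l + m).
  move=> /bx xx /by' yy.
  have [] := H (x' - x0) (y' - y0) (le_lt_trans xx ld) (le_lt_trans yy md).
  rewrite !(addrC _ (_ - _)) !subrK => H1 H2.
  by split; [apply: le_trans H1 _ | apply: le_trans H2 _]; rewrite ler_wpM2l// lerD.
have yl : y \in `[y, y + m] by rewrite in_itv/= lexx lerDl ltW.
have yr : y + m \in `[y, y + m] by rewrite in_itv/= lexx lerDl ltW.
have xl : x \in `[x, x + l] by rewrite in_itv/= lexx lerDl ltW.
have xr : x + l \in `[x, x + l] by rewrite in_itv/= lexx lerDl ltW.
have cP y' : y' \in `[y, y + m] -> {in `[x, x + l], continuous (P ^~ y')}.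
  by move=> yy x' xx; apply: (closed_form_continuous (D _ _ xx yy)).1.
have cQ x' : x' \in `[x, x + l] -> {in `[y, y + m], continuous (Q x')}.
  by move=> xx y' yy; apply: (closed_form_continuous (D _ _ xx yy)).2.
have -> : boundary x y l m =
   (intg x (x + l) (fun t => P t y - P t (y + m)) - (- (k * m)) * (x + l - x)) +
   (intg y (y + m) (fun t => Q (x + l) t - Q x t) - (k * l) * (y + m - y)).
  rewrite /boundary !RintegralB//; try exact: continuous_itv_integrable (cP _ _).
  - ring.
  - exact: continuous_itv_integrable (cQ _ _).
  - exact: continuous_itv_integrable (cQ _ _).
apply: le_trans (ler_normD _ _) _.
have -> : 2 * e * (l + m) ^+ 2 =
  (2 * e * (l + m)) * (x + l - x) + (2 * e * (l + m)) * (y + m - y) by ring.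
apply: lerD; apply: Rintegral_itv_near_cst; rewrite ?lerDl ?(ltW l0) ?(ltW m0)//.
- by move=> x' xx; apply: cvgB; exact: cP.
- move=> x' xx; have [/ler_normlP[A1 A2] _] := H' x' y xx yl.
  have [/ler_normlP[B1 B2] _] := H' x' (y + m) xx yr.
  by rewrite ler_norml; apply/andP; split; lra.
- by move=> x' xx; apply: cvgB; exact: cQ.
- move=> y' yy; have [_ /ler_normlP[A1 A2]] := H' x y' xl yy.
  have [_ /ler_normlP[B1 B2]] := H' (x + l) y' xr yy.
  by rewrite ler_norml; apply/andP; split; lra.
Qed.

Lemma nested_itv (a b : nat -> R) : nondecreasing_seq a -> nonincreasing_seq b ->
  (forall n, a n <= b n) -> exists z, forall n, a n <= z <= b n.
Proof.
move=> ha hb ab; exists (sup (range a)).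
have aub n : ubound (range a) (b n).
  move=> _ [k _ <-]; have [kn|/ltnW nk] := leqP k n.
    by apply: le_trans (ab n); exact: ha.
  by apply: le_trans (ab k) _; exact: hb.
have ne : (range a) !=set0 by exists (a 0%N); exists 0%N.
move=> n; apply/andP; split.
  by apply: ub_le_sup; [exists (b 0%N); exact: aub | exists n].
exact: ge_sup ne (aub n).
Qed.

Lemma closed_form_onS x y l m x' y' l' m' : x <= x' -> x' + l' <= x + l ->
  y <= y' -> y' + m' <= y + m ->
  closed_form_on x y l m -> closed_form_on x' y' l' m'.
Proof.
move=> ? ? ? ? D x'' y''; rewrite !in_itv/= => /andP[? ?] /andP[? ?].
by apply: D; rewrite in_itv/=; apply/andP; split; lra.
Qed.

(* Goursat's bisection argument. *)
Lemma boundary_eq0 x y l m : 0 < l -> 0 < m -> closed_form_on x y l m ->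
  boundary x y l m = 0.
Proof.
move=> l0 m0 D; apply/eqP; rewrite -normr_eq0 eq_le normr_ge0 andbT leNgt.
apply/negP; set c := `|_| => c0.
pose h n : R := 2^-1 ^+ n; have h0 n : 0 < h n by rewrite exprn_gt0.
have hS n : h n = h n.+1 + h n.+1 by rewrite /h exprS; lra.
(* Stage [n] is a subrectangle scaled by [2^-n] whose boundary integral is still at least
   [c / 4^n]. *)
pose inv n (p : R * R) := [/\ x <= p.1, p.1 + l * h n <= x + l, y <= p.2,
  p.2 + m * h n <= y + m & c * h n ^+ 2 <= `|boundary p.1 p.2 (l * h n) (m * h n)|].
(* The invariant is a premise under the existential, so that [choice] yields a total function. A
   corner moves by at most half a side, which keeps the rectangles nested. *)
have step (np : nat * (R * R)) : exists p', inv np.1 np.2 -> [/\ inv np.1.+1 p',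
    np.2.1 <= p'.1 <= np.2.1 + l * h np.1.+1 & np.2.2 <= p'.2 <= np.2.2 + m * h np.1.+1].
  case: np => n p /=; have [|] := pselect (inv n p); last by exists p.
  case; case: p => x' y' /= xx xl yy yl.
  set l' := l * h n.+1; set m' := m * h n.+1.
  have -> : l * h n = l' + l' by rewrite hS mulrDr.
  have -> : m * h n = m' + m' by rewrite hS mulrDr.
  have l'0 : 0 < l' by rewrite mulr_gt0.
  have m'0 : 0 < m' by rewrite mulr_gt0.
  have El : l * h n = l' + l' by rewrite hS mulrDr.
  have Em : m * h n = m' + m' by rewrite hS mulrDr.
  rewrite El in xl; rewrite Em in yl.
  rewrite boundary_split ?(ltW l'0) ?(ltW m'0)//; last exact: closed_form_onS D.
  have -> : c * h n ^+ 2 = (c * h n.+1 ^+ 2) *+ 4 by rewrite hS; ring.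
  set C := c * _ => HC.
  have H a b : x <= a -> a + l' <= x + l -> y <= b -> b + m' <= y + m ->
      x' <= a <= x' + l' -> y' <= b <= y' + m' -> C <= `|boundary a b l' m'| ->
      exists p' : R * R, [/\ x <= p'.1, p'.1 + l' <= x + l, y <= p'.2, p'.2 + m' <= y + m
      & C <= `|boundary p'.1 p'.2 l' m'| ] /\ (x' <= p'.1 <= x' + l' /\ y' <= p'.2 <= y' + m').
    by move=> *; exists (a, b).
  suff [p' [H1 [H2 H3]]] : exists p' : R * R,
      [/\ x <= p'.1, p'.1 + l' <= x + l, y <= p'.2, p'.2 + m' <= y + m
      & C <= `|boundary p'.1 p'.2 l' m'| ] /\
      (x' <= p'.1 <= x' + l' /\ y' <= p'.2 <= y' + m').
    by exists p'.
  have [|n1] := leP C `|boundary x' y' l' m'|.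
    by apply: H => //; try (by apply/andP; split; lra); lra.
  have [|n2] := leP C `|boundary (x' + l') y' l' m'|.
    by apply: H => //; try (by apply/andP; split; lra); lra.
  have [|n3] := leP C `|boundary x' (y' + m') l' m'|.
    by apply: H => //; try (by apply/andP; split; lra); lra.
  have [|n4] := leP C `|boundary (x' + l') (y' + m') l' m'|.
    by apply: H => //; try (by apply/andP; split; lra); lra.
  (* If all four quarters were below [C], their sum would be below [C *+ 4]. *)
  exfalso; move: HC; apply/negP; rewrite -ltNge.
  apply: le_lt_trans (ler_normD _ _) _; apply: le_lt_trans (lerD (ler_normD _ _) (lexx _)) _.
  apply: le_lt_trans (lerD (lerD (ler_normD _ _) (lexx _)) (lexx _)) _.
  by rewrite (_ : C *+ 4 = C + C + C + C); [rewrite !ltrD | ring].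
have [f Hf] := choice step.
pose g := fix g n := if n is n'.+1 then f (n', g n') else (x, y).
have Hg n : inv n (g n).
  elim: n => [|n IH]; last by have [] := Hf (n, g n) IH.
  by rewrite /inv /= /h expr0 !mulr1 expr1n mulr1 !lexx.
have Sg n : (g n).1 <= (g n.+1).1 <= (g n).1 + l * h n.+1 /\
    (g n).2 <= (g n.+1).2 <= (g n).2 + m * h n.+1.
  by have [] := Hf (n, g n) (Hg n).
have [x0 X0] : exists z, forall n, (g n).1 <= z <= (g n).1 + l * h n.
  apply: nested_itv => [||n]; last by rewrite lerDl mulr_ge0 ?ltW.
    by apply/nondecreasing_seqP => n; have [/andP[]] := Sg n.
  apply/nonincreasing_seqP => n; have [/andP[_]] := Sg n.
  by rewrite [in _ -> _](hS n); lra.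
have [y0 Y0] : exists z, forall n, (g n).2 <= z <= (g n).2 + m * h n.
  apply: nested_itv => [||n]; last by rewrite lerDl mulr_ge0 ?ltW.
    by apply/nondecreasing_seqP => n; have [_ /andP[]] := Sg n.
  apply/nonincreasing_seqP => n; have [_ /andP[_]] := Sg n.
  by rewrite [in _ -> _](hS n); lra.
have xx : x0 \in `[x, x + l] by move: (X0 0%N); rewrite in_itv/= /h expr0 mulr1.
have yy : y0 \in `[y, y + m] by move: (Y0 0%N); rewrite in_itv/= /h expr0 mulr1.
have [p [k [q K]]] := D _ _ xx yy.
have lm0 : 0 < l + m by rewrite addr_gt0.
(* With this constant [boundary_small] bounds stage [n] by [c * h n ^+ 2 / 2], half of the lower
   bound in the invariant. *)
have [|d d0 Hd] := K (c / (4 * (l + m) ^+ 2)).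
  by rewrite divr_gt0// mulr_gt0// exprn_gt0.
have [n hn] : exists n, (l + m) * h n < d.
  have : (l + m) * h n @[n --> \oo] --> (l + m) * 0.
    by apply: cvgMr; apply: cvg_expr; rewrite ger0_norm ?invr_ge0// invf_lt1// ltr1n.
  rewrite mulr0 => /cvgr0_norm_lt/(_ _ d0)[n _ /(_ n (leqnn n))] H.
  by exists n; apply: le_lt_trans H; exact: ler_norm.
have [? ? ? ?] := Hg n; apply/negP; rewrite -ltNge.
apply: (@le_lt_trans _ _ (2 * (c / (4 * (l + m) ^+ 2)) * (l * h n + m * h n) ^+ 2)).
  apply: (boundary_small _ _ _ _ _ _ _ _ Hd) => //; rewrite ?mulr_gt0 ?in_itv/= ?X0 ?Y0//.
  - by apply: le_lt_trans hn; rewrite ler_wpM2r ?ltW// ltrDl.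
  - by apply: le_lt_trans hn; rewrite ler_wpM2r ?ltW// ltrDr.
  - by rewrite divr_ge0 ?ltW// mulr_gt0// exprn_gt0.
  - exact: closed_form_onS D.
have -> : 2 * (c / (4 * (l + m) ^+ 2)) * (l * h n + m * h n) ^+ 2 = c * h n ^+ 2 / 2.
  by field; rewrite gt_eqF.
by have : 0 < c * h n ^+ 2; [rewrite mulr_gt0// exprn_gt0 | lra].
Qed.

End green.

(** * Complex differentiability and the Cauchy formula *)

Section modulus.
Variables (R : realType) (V : normedModType R[i]).
(** Norms over [R[i]] take values in [R[i]]; the real version makes real order reasoning
    available. *)
Definition modulus (x : V) : R := complex.Re `|x|.

Lemma normE x : `|x| = (modulus x)%:C.
Proof. by rewrite RRe_real// normr_real. Qed.

Lemma modulus_ge0 x : 0 <= modulus x.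
Proof. by have := normr_ge0 x; rewrite normE lecR. Qed.

Lemma modulus0 : modulus 0 = 0.
Proof. by rewrite /modulus normr0. Qed.

Lemma modulusD x y : modulus (x + y) <= modulus x + modulus y.
Proof. by rewrite -lecR rmorphD/= -!normE ler_normD. Qed.

Lemma modulusN x : modulus (- x) = modulus x.
Proof. by rewrite /modulus normrN. Qed.

Lemma modulus_gt0 x : x != 0 -> 0 < modulus x.
Proof. by rewrite -normr_gt0 normE ltcR. Qed.

End modulus.

Section complex_modulus.
Variable R : realType.
Implicit Types z w : R[i].

Lemma modulusZ (V : normedModType R[i]) z (x : V) : modulus (z *: x) = modulus z * modulus x.
Proof. by apply: complexI; rewrite rmorphM/= -!normE normrZ. Qed.

Lemma modulusM z w : modulus (z * w) = modulus z * modulus w.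
Proof. exact: modulusZ. Qed.

Lemma modulusV z : modulus z^-1 = (modulus z)^-1.
Proof. by apply: complexI; rewrite fmorphV/= -!normE normfV. Qed.

Lemma modulusR (x : R) : modulus x%:C = `|x|.
Proof. by apply: complexI; rewrite -normE normc_def/= expr0n addr0 sqrtr_sqr. Qed.

Lemma le_Re_modulus z : `|complex.Re z| <= modulus z.
Proof. by rewrite -lecR -normE normc_ge_Re. Qed.

Lemma le_Im_modulus z : `|complex.Im z| <= modulus z.
Proof.
rewrite -lecR -normE normc_def lecR -sqrtr_sqr ler_wsqrtr// lerDr sqr_ge0 //.
Qed.

Lemma modulus_le z : modulus z <= `|complex.Re z| + `|complex.Im z|.
Proof.
rewrite -lecR -normE normc_def lecR -[leRHS]ger0_norm ?addr_ge0//.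
rewrite -sqrtr_sqr ler_wsqrtr// sqrrD !real_normK ?num_real//.
by rewrite lerD2r lerDl mulrn_wge0// mulr_ge0.
Qed.

End complex_modulus.

(** * Complex differentiability in one variable, and the exponential *)

Section caratheodory.
Variable R : realType.
Local Notation C := R[i].
Local Notation at0 := (nbhs (0 : C)).
Implicit Types f g : C -> C.

(** A positive element of [R[i]] is real, so real epsilons suffice. *)
Lemma cvg_modulusP (T : Type) (F : set_system T) {FF : Filter F} (V : normedModType C)
    (u : T -> V) (l : V) :
  u @ F --> l <-> forall e : R, 0 < e -> \forall x \near F, modulus (l - u x) <= e.
Proof.
split=> [/cvgrPdist_le H e e0|H].
  by have := H e%:C; rewrite ltcR => /(_ e0); apply: filterS => x; rewrite normE lecR.
apply/cvgrPdist_le => -[e ei]; rewrite ltcE/= => /andP[/eqP ei0 e0].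
by have := H e e0; apply: filterS => x; rewrite normE lecE/= ei0 eqxx.
Qed.

Lemma near0_modulusP (V : normedModType C) (P : set V) : (\forall x \near 0, P x) <->
  exists2 d : R, 0 < d & forall h, modulus h < d -> P h.
Proof.
split.
  move=> /nbhs_ballP[[d di] /=]; rewrite ltcE/= => /andP[/eqP di0 d0] H.
  exists d => // h hd; apply: H; rewrite -ball_normE/= sub0r normrN normE ltcE/=.
  by rewrite di0 eqxx.
move=> [d d0 H]; apply/nbhs_ballP; exists d%:C; first by rewrite /= ltcR.
by move=> h; rewrite -ball_normE/= sub0r normrN normE ltcR; exact: H.
Qed.

(* Specializations to [R[i]], for which canonical structure inference would
   unfold the filter. *)
Lemma cvgDC (u v : C -> C) (a b : C) :
  u @ at0 --> a -> v @ at0 --> b -> u x + v x @[x --> at0] --> a + b.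
Proof. exact: cvgD. Qed.

Lemma cvgMC (u v : C -> C) (a b : C) :
  u @ at0 --> a -> v @ at0 --> b -> u x * v x @[x --> at0] --> a * b.
Proof. exact: cvgM. Qed.

Lemma cvgVC (u : C -> C) (a : C) :
  a != 0 -> u @ at0 --> a -> (u x)^-1 @[x --> at0] --> a^-1.
Proof. exact: cvgV. Qed.

Lemma cvgNC (u : C -> C) (a : C) :
  u @ at0 --> a -> - u x @[x --> at0] --> - a.
Proof. exact: cvgN. Qed.

Lemma cvg_cstC (a : C) : a @[x --> at0] --> a.
Proof. exact: cvg_cst. Qed.

Lemma cvg_idC : h @[h --> at0] --> (0 : C).
Proof. by apply: cvg_id. Qed.

(* Caratheodory's form of complex differentiability: the difference quotient
   extends continuously. *)
Definition cderiv f (z d : C) := exists2 phi : C -> C,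
  forall h, f (z + h) - f z = phi h * h & phi h @[h --> at0] --> d.

Lemma cderiv_cvg f z d : cderiv f z d -> f (z + h) @[h --> at0] --> f z.
Proof.
move=> [phi H cphi].
have := cvgDC (cvgMC cphi cvg_idC) (@cvg_cstC (f z)); rewrite mulr0 add0r.
rewrite (_ : (fun h => phi h * h + f z) = (fun h => f (z + h)))//.
by apply/funext => h; rewrite -H subrK.
Qed.

Lemma cderivM f g z d e : cderiv f z d -> cderiv g z e ->
  cderiv (fun x => f x * g x) z (d * g z + f z * e).
Proof.
move=> [phi Hf cphi] dg; have cg := cderiv_cvg dg; case: dg => [psi Hg cpsi].
exists (fun h => phi h * g (z + h) + f z * psi h).
  by move=> h; rewrite mulrDl mulrAC -Hf -mulrA -Hg; ring.
by apply: cvgDC (cvgMC cphi cg) (cvgMC (@cvg_cstC _) cpsi).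
Qed.

Lemma cderivV (z : C) : z != 0 -> cderiv (fun x => x^-1) z (- (z * z)^-1).
Proof.
move=> z0.
(* Inversion sends [0] to [0], which dictates the value at [h = - z]; this point is away from
   [h = 0] and does not affect the limit. *)
exists (fun h => if z + h == 0 then z^-1 * z^-1 else - (z * (z + h))^-1).
  move=> h; case: eqP => [zh|/eqP zh].
    by rewrite zh invr0 sub0r (_ : h = - z) ?mulrN ?mulfVK//; apply/eqP; rewrite -addr_eq0 addrC zh.
  have H (F : fieldType) (a b : F) : a != 0 -> a + b != 0 ->
      (a + b)^-1 - a^-1 = - (a * (a + b))^-1 * b by move=> *; field; exact/andP.
  exact: H.
have czh : z + h @[h --> at0] --> z.
  by have := cvgDC (@cvg_cstC z) cvg_idC; rewrite addr0.
apply: (@cvg_trans _ ((- (z * (z + h))^-1) @[h --> at0])).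
  apply: near_eq_cvg; near=> h; rewrite ifF//; apply/negbTE.
  near: h; apply/near0_modulusP; exists (modulus z); first exact: modulus_gt0.
  move=> h; apply: contraTneq => /eqP; rewrite addrC addr_eq0 => /eqP ->.
  by rewrite modulusN ltxx.
apply: cvgNC; apply: cvgVC; first by rewrite mulf_neq0.
exact: cvgMC (@cvg_cstC _) czh.
Unshelve. all: by end_near. Qed.

(** [phi] has a value at the increment [0] too, so the inner increment [psi h * h] is allowed to
    vanish. *)
Lemma cderiv_comp f g z d e : cderiv g z e -> cderiv f (g z) d ->
  cderiv (f \o g) z (d * e).
Proof.
move=> [psi Hg cpsi] [phi Hf cphi].
exists (fun h => phi (psi h * h) * psi h).
  by move=> h /=; rewrite -mulrA -Hf -Hg (addrC (g z)) subrK.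
have c0 : psi h * h @[h --> at0] --> (0 : C).
  by have := cvgMC cpsi cvg_idC; rewrite mulr0.
exact: cvgMC (cvg_comp (fun h => psi h * h) phi c0 cphi) cpsi.
Qed.

Lemma cderivB_cst f z d c : cderiv f z d -> cderiv (fun x => f x - c) z d.
Proof. by move=> [phi Hf cphi]; exists phi => // h; rewrite -Hf; ring. Qed.

Lemma cderiv_modulusP f z d : cderiv f z d <-> forall e : R, 0 < e ->
  exists2 r : R, 0 < r &
    forall h, modulus h < r -> modulus (f (z + h) - f z - d * h) <= e * modulus h.
Proof.
split.
  move=> [phi Hf /cvg_modulusP H] e /H /near0_modulusP[r r0 {}H]; exists r => // h hr.
  by rewrite Hf -mulrBl modulusM ler_wpM2r ?modulus_ge0// -modulusN opprB H.
move=> H; exists (fun h => if h == 0 then d else (f (z + h) - f z) / h).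
  by move=> h; case: eqP => [->|/eqP h0]; rewrite ?addr0 ?subrr ?mulr0 ?mulfVK.
apply/cvg_modulusP => e e0; have [r r0 {}H] := H e e0; apply/near0_modulusP; exists r => // h hr.
have [_|h0] := eqVneq h 0; first by rewrite subrr modulus0 ltW.
rewrite -(ler_pM2r (modulus_gt0 h0)) -modulusM -modulusN mulrBl mulfVK// opprB.
exact: H.
Qed.

(** The form is the imaginary part of [g dz]. By the Cauchy-Riemann equations the [y]-derivative of
    [Im g] and the [x]-derivative of [Re g] are both [Re d]. *)
Lemma cderiv_closed_form g x y d : cderiv g (x +i* y) d ->
  closed_form_at (fun x y => complex.Im (g (x +i* y))) (fun x y => complex.Re (g (x +i* y))) x y.
Proof.
move=> /cderiv_modulusP H; exists (complex.Im d), (complex.Re d), (- complex.Im d) => e e0.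
have [|r r0 {}H] := H e => //; exists (r / 2); first by rewrite divr_gt0.
move=> h1 h2 hr1 hr2; have := H (h1 +i* h2).
have mh := modulus_le (h1 +i* h2).
rewrite (le_lt_trans mh) /=; last by lra.
move=> /(_ isT) {}H.
have {}H : modulus (g ((x +i* y) + (h1 +i* h2)) - g (x +i* y) - d * (h1 +i* h2)) <= e * (`|h1| + `|h2|).
  by apply: le_trans H _; rewrite ler_wpM2l// ltW.
split.
  apply: le_trans H; apply: le_trans (le_Im_modulus _).
  rewrite le_eqVlt; apply/orP; left; apply/eqP; congr (`| _ |).
  rewrite (_ : (x +i* y) + (h1 +i* h2) = (x + h1) +i* (y + h2))//.
  move: (g _) (g _) => [a b] [a' b']; case: d => d1 d2 /=. ring.
apply: le_trans H; apply: le_trans (le_Re_modulus _).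
rewrite le_eqVlt; apply/orP; left; apply/eqP; congr (`| _ |).
rewrite (_ : (x +i* y) + (h1 +i* h2) = (x + h1) +i* (y + h2))//.
move: (g _) (g _) => [a b] [a' b']; case: d => d1 d2 /=. ring.
Qed.

Definition cis (y : R) : C := cos y +i* sin y.
Definition cexp (z : C) : C := (expR (complex.Re z))%:C * cis (complex.Im z).

Lemma cexpD z h : cexp (z + h) = cexp z * cexp h.
Proof.
case: z h => [a b] [c d]; rewrite /cexp /cis /= expRD cosD sinD.
by apply/eqP; rewrite eq_complex/=; apply/andP; split; apply/eqP; ring.
Qed.

Lemma derive_eps (f : R -> R) (x d : R) : is_derive x 1 f d -> forall e, 0 < e ->
  exists2 r, 0 < r & forall h, `|h| < r -> `|f (x + h) - f x - d * h| <= e * `|h|.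
Proof.
move=> [fd fe] e e0.
have : h^-1 *: (f (h *: 1 + x) - f x) @[h --> 0^'] --> d by rewrite -fe; exact: fd.
move=> /cvgrPdist_le/(_ _ e0) /nbhs_ballP[r /= r0 H]; exists r => // h hr.
have [->|h0] := eqVneq h 0; first by rewrite addr0 subrr mulr0 subrr !normr0 mulr0.
have := H h; rewrite -ball_normE/= sub0r normrN => /(_ hr h0).
rewrite -(ler_pM2r (_ : 0 < `|h|)) ?normr_gt0// -normrM mulrBl distrC.
by rewrite /GRing.scale/= mulr1 mulrAC mulVf// mul1r (addrC h).
Qed.

Lemma cderiv_cexp z : cderiv cexp z (cexp z).
Proof.
(* By [cexpD] the increment at [z] is [cexp z] times the increment at [0]. *)
suff H : cderiv cexp 0 1.
  case: H => phi H cphi; exists (fun h => cexp z * phi h).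
    by move=> h; rewrite cexpD -mulrA -H add0r (_ : cexp 0 = 1) ?mulrBr ?mulr1// /cexp/=
      expR0 /cis cos0 sin0 mul1r.
  by have := cvgMC (@cvg_cstC (cexp z)) cphi; rewrite mulr1.
(* The real and the imaginary part of the error each cost [3 * (e * m)], whence the [6]. *)
apply/cderiv_modulusP => e0 e00; pose e := Num.min 1 (e0 / 6).
have e_gt0 : 0 < e by rewrite lt_min ltr01 divr_gt0.
have e1 : e <= 1 by rewrite ge_min lexx.
have ee0 : 6 * e <= e0 by rewrite mulrC -ler_pdivlMr// ge_min lexx orbT.
have [r1 r10 H1] := derive_eps (is_derive_expR (0 : R)) e_gt0.
have [r2 r20 H2] := derive_eps (is_derive_cos (0 : R)) e_gt0.
have [r3 r30 H3] := derive_eps (is_derive_sin (0 : R)) e_gt0.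
pose r := Num.min (Num.min r1 (e / 2)) (Num.min r2 r3).
exists r; first by rewrite !lt_min r10 r20 r30 divr_gt0.
move=> h; have := le_Im_modulus h; have := le_Re_modulus h.
case: h => a b; move: (modulus _) => m /= am bm mr.
move: mr; rewrite !lt_min -!andbA => /and4P[mr1 mre mr2 mr3].
have := H1 a (le_lt_trans am mr1); have := H2 b (le_lt_trans bm mr2).
have := H3 b (le_lt_trans bm mr3).
rewrite !add0r expR0 cos0 sin0 subr0 !mul1r oppr0 mul0r subr0 => {}H3 {}H2 {}H1.
apply: le_trans (modulus_le _) _.
have [-> ->] : complex.Re (cexp (a +i* b) - cexp 0 - a +i* b) = expR a * cos b - 1 - a /\
    complex.Im (cexp (a +i* b) - cexp 0 - a +i* b) = expR a * sin b - b.
  by rewrite /cexp/= expR0 cos0 sin0; split; ring.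
have ae : `|a| <= e / 2 by apply: ltW; apply: le_lt_trans mre.
have E : `|expR a - 1| <= e.
  rewrite -(subrK a (_ - _)); apply: le_trans (ler_normD _ _) _.
  apply: le_trans (lerD H1 ae) _; have : e * `|a| <= 1 * `|a| by rewrite ler_wpM2r.
  by lra.
have E2 : expR a <= 2 by move: E => /ler_normlP[]; lra.
have c1 : `|cos b| <= 1 by rewrite ler_norml cos_geN1 cos_le1.
have P1 : `|(expR a - 1 - a) * cos b| <= e * m.
  rewrite normrM -[leRHS]mulr1 ler_pM//; apply: le_trans H1 _.
  by rewrite ler_wpM2l// ltW.
have P2 : `|(1 + a) * (cos b - 1)| <= 2 * (e * m).
  rewrite normrM ler_pM//.
    by apply: le_trans (ler_normD _ _) _; rewrite normr1; lra.
  by apply: le_trans H2 _; rewrite ler_wpM2l// ltW.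
have P3 : `|expR a * (sin b - b)| <= 2 * (e * m).
  rewrite normrM [`|expR a|]ger0_norm ?expR_ge0// ler_pM// ?expR_ge0//.
  by apply: le_trans H3 _; rewrite ler_wpM2l// ltW.
have P4 : `|(expR a - 1) * b| <= e * m.
  by rewrite normrM ler_pM.
have m0 : 0 <= m by exact: le_trans (normr_ge0 a) am.
have em : 6 * (e * m) <= e0 * m by rewrite mulrA ler_wpM2r.
have Q1 : `|expR a * cos b - 1 - a| <= 3 * (e * m).
  rewrite (_ : _ - a = (expR a - 1 - a) * cos b + (1 + a) * (cos b - 1)); last by ring.
  by apply: le_trans (ler_normD _ _) _; lra.
have Q2 : `|expR a * sin b - b| <= 3 * (e * m).
  rewrite (_ : _ - b = expR a * (sin b - b) + (expR a - 1) * b); last by ring.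
  by apply: le_trans (ler_normD _ _) _; lra.
lra.
Qed.

End caratheodory.

(** * The mean value property and the Cauchy estimate *)

Section cauchy.
Variable R : realType.
Local Notation C := R[i].
Local Notation mu := (@lebesgue_measure R).
Local Notation intg a b f := (\int[mu]_(x in `[a, b]) f x).
Local Notation circle_int f := (\int[mu]_(y in `[0, pi *+ 2]) f y).

Lemma modulus1 : modulus (1 : C) = 1.
Proof. by rewrite /modulus normr1. Qed.

Lemma cisD2pi (y : R) : cis (y + pi *+ 2) = cis y.
Proof. by rewrite /cis mulr2n addrA !cosDpi !sinDpi !opprK. Qed.

Lemma modulus_cis (y : R) : modulus (cis y) = 1.
Proof. by rewrite /modulus normc_def/= cos2Dsin2 sqrtr1. Qed.

Lemma modulus_rcis r (y : R) : 0 < r -> modulus (r%:C * cis y) = r.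
Proof. by move=> r0; rewrite modulusM modulus_cis mulr1 modulusR gtr0_norm. Qed.

Lemma rcis_neq0 r (y : R) : 0 < r -> r%:C * cis y != 0.
Proof.
by move=> r0; apply: contraTneq r0 => H; rewrite -leNgt -(modulus0 C^o) -H modulusM
  modulus_cis mulr1 modulusR ler_norm.
Qed.

Lemma cexpE (x y : R) : cexp (x +i* y) = (expR x)%:C * cis y.
Proof. by []. Qed.

Lemma cderiv_cexp_closed q (x y : R) :
  (exists d, cderiv q (cexp (x +i* y)) d) ->
  closed_form_at (fun x y => complex.Im (q (cexp (x +i* y))))
    (fun x y => complex.Re (q (cexp (x +i* y)))) x y.
Proof.
move=> [d Hd]; exact: cderiv_closed_form (cderiv_comp (cderiv_cexp _) Hd).
Qed.

(** In logarithmic coordinates the circle is the vertical line [x = ln r], along which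
    [closed_form_continuous] applies. *)
Lemma continuous_circle (q : C -> C) (r : R) : 0 < r ->
  (forall z, modulus z = r -> exists d, cderiv q z d) ->
  continuous (fun y => complex.Re (q (r%:C * cis y))).
Proof.
move=> r0 H y.
have -> : (fun y => complex.Re (q (r%:C * cis y))) =
    (fun y => complex.Re (q (cexp (ln r +i* y)))).
  by apply/funext => z; rewrite cexpE lnK.
have D : closed_form_at (fun x y => complex.Im (q (cexp (x +i* y))))
    (fun x y => complex.Re (q (cexp (x +i* y)))) (ln r) y.
  by apply: cderiv_cexp_closed; apply: H; rewrite cexpE lnK ?posrE// modulus_rcis.
exact: (closed_form_continuous D).2.
Qed.

(* In the coordinates [z = exp (x + i y)] the form [Im q dx + Re q dy] is closed
   away from [z = 0]; by periodicity the two sides [y = 0] and [y = 2 pi] cancel, so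
   the integral over a circle does not depend on its radius, which tends to [0]. *)
Lemma mean_value (q : C -> C) (r : R) (l : C) : 0 < r ->
  (forall z, z != 0 -> modulus z <= r -> exists d, cderiv q z d) ->
  (forall e : R, 0 < e -> exists2 d : R, 0 < d &
    forall z, z != 0 -> modulus z < d -> modulus (q z - l) <= e) ->
  circle_int (fun y => complex.Re (q (r%:C * cis y))) = complex.Re l * (pi *+ 2).
Proof.
move=> r0 dq ql.
have tp0 : 0 < pi *+ 2 :> R by rewrite mulrn_wgt0// pi_gt0.
have M (s : R) : 0 < s -> s < r ->
    circle_int (fun y => complex.Re (q (r%:C * cis y))) =
    circle_int (fun y => complex.Re (q (s%:C * cis y))).
  move=> s0 sr.
  pose P x y : R := complex.Im (q (cexp (x +i* y))).
  pose Q x y : R := complex.Re (q (cexp (x +i* y))).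
  have sr' : 0 < ln r - ln s by rewrite subr_gt0 ltr_ln.
  (* [cexp] maps this rectangle onto the annulus between the radii [s] and [r], which avoids [0]. *)
  have D : closed_form_on P Q (ln s) 0 (ln r - ln s) (pi *+ 2).
    move=> x y; rewrite in_itv/= => /andP[_ xr] _; apply: cderiv_cexp_closed.
    apply: dq; first by rewrite cexpE rcis_neq0// expR_gt0.
    rewrite cexpE modulus_rcis ?expR_gt0//.
    by rewrite -[leRHS]lnK// ler_expR; lra.
  have := boundary_eq0 sr' tp0 D.
  rewrite /boundary add0r (addrC (ln s)) subrK.
  have -> : P ^~ (pi *+ 2) = P ^~ 0.
    by apply/funext => x; rewrite /P !cexpE -[X in cis X]add0r cisD2pi.
  rewrite subrr add0r => /eqP; rewrite subr_eq0 => /eqP.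
  have E t : 0 < t -> Q (ln t) = fun y => complex.Re (q (t%:C * cis y)).
    by move=> t0; apply/funext => y; rewrite /Q cexpE lnK.
  by rewrite !E.
apply/eqP; rewrite -subr_eq0 -normr_le0; apply/ler_addgt0Pr => e e0; rewrite add0r.
have [|d d0 Hd] := ql (e / (pi *+ 2)); first by rewrite divr_gt0.
pose s := Num.min (d / 2) (r / 2).
have s0 : 0 < s by rewrite lt_min !divr_gt0.
have sr : s < r by rewrite gt_min (_ : r / 2 < r) ?orbT//; lra.
have sd : s < d by rewrite gt_min (_ : d / 2 < d)//; lra.
rewrite (M s)//.
have H : {in `[0, pi *+ 2], continuous (fun y => complex.Re (q (s%:C * cis y)))}.
  move=> y _; apply: continuous_circle => // z zs; apply: dq; last by rewrite zs ltW.
  by apply: contraTneq s0 => z0; rewrite -zs z0 modulus0 ltxx.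
have := Rintegral_itv_near_cst (ltW tp0) H; rewrite subr0.
move=> /(_ (complex.Re l) (e / (pi *+ 2))); rewrite divfK ?gt_eqF//; apply => y _.
apply: le_trans (Hd _ (rcis_neq0 y s0) _); last by rewrite modulus_rcis.
by apply: le_trans (le_Re_modulus _); rewrite raddfB.
Qed.

(** The integrand of the Cauchy formula for the derivative at [0]. Subtracting [F 0] makes it a
    difference quotient, which has a limit at the centre. *)
Definition cauchy_quot (F : C -> C) (r y : R) : C :=
  (F (r%:C * cis y) - F 0) / (r%:C * cis y).

Lemma cderiv_quot (F : C -> C) z d : z != 0 -> cderiv F z d ->
  exists e, cderiv (fun z => (F z - F 0) / z) z e.
Proof.
by move=> z0 H; eexists; exact: cderivM (cderivB_cst (F 0) H) (cderivV z0).
Qed.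

(** The difference quotient is differentiable off [0] and tends to [d] at [0], which is what
    [mean_value] asks for; no removable singularity theorem enters. *)
Lemma cauchy_deriv (F : C -> C) (r : R) (d : C) : 0 < r ->
  (forall z, modulus z <= r -> exists e, cderiv F z e) -> cderiv F 0 d ->
  circle_int (fun y => complex.Re (cauchy_quot F r y)) = complex.Re d * (pi *+ 2).
Proof.
move=> r0 dF dF0.
apply: (@mean_value (fun z => (F z - F 0) / z)) => //.
  by move=> z z0 /dF[e]; exact: cderiv_quot.
move=> e /((cderiv_modulusP _ _ _).1 dF0)[s s0 H]; exists s => // z z0 zs.
have := H z zs; rewrite add0r -(ler_pM2r (_ : 0 < (modulus z)^-1)) ?invr_gt0 ?modulus_gt0//.
rewrite mulfK ?gt_eqF ?modulus_gt0//; apply: le_trans.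
rewrite -[leLHS](mulfK (_ : modulus z != 0)) ?gt_eqF ?modulus_gt0//.
by rewrite -modulusM mulrBl mulfVK.
Qed.

Lemma continuous_cauchy_quot (F : C -> C) (c : C) (r : R) : 0 < r ->
  (forall z, modulus z <= r -> exists e, cderiv F z e) ->
  continuous (fun y => complex.Re (c * cauchy_quot F r y)).
Proof.
move=> r0 dF; apply: (@continuous_circle (fun z => c * ((F z - F 0) / z))) => // z zr.
have [|e He] := dF z; first by rewrite zr.
have [|e' He'] := cderiv_quot _ He.
  by apply: contraTneq r0 => z0; rewrite -zr z0 modulus0 ltxx.
have Hc : cderiv (fun _ => c) z 0.
  by exists (fun _ => 0); [move=> h; rewrite mul0r subrr | exact: cvg_cstC].
by eexists; exact: cderivM Hc He'.
Qed.

Lemma cderivZ (F : C -> C) z c d : cderiv F z d -> cderiv (fun x => c * F x) z (c * d).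
Proof.
move=> H.
have Hc : cderiv (fun _ => c) z 0.
  by exists (fun _ => 0); [move=> h; rewrite mul0r subrr | exact: cvg_cstC].
by have := cderivM Hc H; rewrite mul0r add0r.
Qed.

(** One factor [2] bounds [F z - F 0]; the other comes from estimating the real and imaginary parts
    of [d] separately, through [c = 1] and [c = 'i]. *)
Lemma cauchy_estimate (F : C -> C) (r M : R) (d : C) : 0 < r ->
  (forall z, modulus z <= r -> exists e, cderiv F z e) -> cderiv F 0 d ->
  (forall z, modulus z <= r -> modulus (F z) <= M) ->
  modulus d <= 4 * M / r.
Proof.
move=> r0 dF dF0 FM.
have tp0 : 0 < pi *+ 2 :> R by rewrite mulrn_wgt0// pi_gt0.
suff H (c : C) : modulus c = 1 -> `|complex.Re (c * d)| <= 2 * M / r.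
  apply: le_trans (modulus_le _) _.
  have -> : 4 * M / r = 2 * M / r + 2 * M / r by rewrite -mulrDl -mulrDl; congr (_ * _ / _); lra.
  apply: lerD; first by rewrite -[d]mul1r H// modulus1.
  rewrite -normrN -ReiNIm mulrC H// /modulus normc_def/=.
  by rewrite expr0n/= add0r expr1n sqrtr1.
move=> c1; rewrite -(ler_pM2r tp0) -[X in _ * X <= _]gtr0_norm// -normrM.
have dcF z : modulus z <= r -> exists e, cderiv (fun x => c * F x) z e.
  by move=> /dF[e He]; exists (c * e); exact: cderivZ.
rewrite -(cauchy_deriv r0 dcF (cderivZ c dF0)).
rewrite -[pi *+ 2 in leRHS]subr0; apply: le_norm_Rintegral_itv; first exact: ltW.
  move=> y _; have := @continuous_cauchy_quot (fun x => c * F x) 1 r r0 dcF y.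
  by under eq_fun do rewrite mul1r.
move=> y _; apply: le_trans (le_Re_modulus _) _.
have E : modulus ((r%:C * cis y)^-1) = r^-1.
  have := modulusM (r%:C * cis y) (r%:C * cis y)^-1.
  rewrite mulfV ?rcis_neq0// modulus1 modulus_rcis// => H.
  by apply: (mulfI (_ : r != 0)); rewrite ?gt_eqF// -H mulfV ?gt_eqF.
rewrite /cauchy_quot modulusM E ler_wpM2r ?invr_ge0 ?(ltW r0)//.
rewrite -mulrBr modulusM c1 mul1r (le_trans (modulusD _ _))// modulusN.
have := FM (r%:C * cis y); rewrite modulus_rcis// => /(_ (lexx _)).
by have := FM 0; rewrite modulus0 => /(_ (ltW r0)); lra.
Qed.

End cauchy.

(** * Differentiating directional derivatives under the Cauchy integral *)

Section osgood.
Variables (R : realType).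
Local Notation C := R[i].
Variable V : normedModType C.
Local Notation mu := (@lebesgue_measure R).
Local Notation circle_int f := (\int[mu]_(y in `[0, pi *+ 2]) f y).
Implicit Types (f : V -> C) (p v : V).

Definition dirderiv f p v d := cderiv (fun z : C => f (p + z *: v)) 0 d.

Lemma dirderiv_line f p v z d : dirderiv f (p + z *: v) v d ->
  cderiv (fun z => f (p + z *: v)) z d.
Proof.
move=> [phi H cphi]; exists phi => // h; rewrite -H.
by rewrite scale0r addr0 add0r scalerDl addrA.
Qed.

Lemma is_derive_eps (g : R -> R) (x d : R) :
  (forall e, 0 < e -> exists2 r, 0 < r & forall h, `|h| < r ->
    `|g (x + h) - g x - d * h| <= e * `|h|) -> is_derive x 1 g d.
Proof.
move=> H.
have E : h^-1 *: (g (h *: 1 + x) - g x) @[h --> 0^'] --> d.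
  apply/cvgrPdist_le => e e0; have [r r0 {}H] := H e e0.
  apply/nbhs_ballP; exists r => //= h; rewrite -ball_normE/= sub0r normrN => hr h0.
  have := H h hr; rewrite -(ler_pM2r (_ : 0 < `|h|^-1)) ?invr_gt0 ?normr_gt0//.
  rewrite mulfK ?normr_eq0//; apply: le_trans; rewrite -normfV -normrM distrC.
  by rewrite mulrBl mulfK// /GRing.scale/= mulr1 mulrC (addrC h).
apply: DeriveDef; last exact: cvg_lim E.
by apply/cvg_ex; exists d.
Qed.

Lemma ReMR (z : C) (h : R) : complex.Re (z * h%:C) = complex.Re z * h.
Proof. by case: z => a b /=; rewrite mulr0 subr0. Qed.

(** The constant [c] selects the real or imaginary part, and [zeta] a real direction inside the
    complex line. *)
Lemma dirderiv_real f p v d (c zeta : C) (x : R) :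
  dirderiv f (p + (x%:C * zeta) *: v) v d ->
  is_derive x 1 (fun t : R => complex.Re (c * f (p + (t%:C * zeta) *: v)))
    (complex.Re (c * (zeta * d))).
Proof.
move=> /cderiv_modulusP H; apply: is_derive_eps => e e0.
have K0 : 0 < modulus c * modulus zeta + 1.
  by rewrite ltr_wpDl ?mulr_ge0 ?modulus_ge0.
have z0 : 0 < modulus zeta + 1 by rewrite ltr_wpDl ?modulus_ge0.
have [|r r0 {}H] := H (e / (modulus c * modulus zeta + 1)); first by rewrite divr_gt0.
exists (r / (modulus zeta + 1)); first by rewrite divr_gt0.
move=> h; rewrite ltr_pdivlMr// => hr.
have hz : modulus (h%:C * zeta) = `|h| * modulus zeta by rewrite modulusM modulusR.
have hzr : modulus (h%:C * zeta) < r.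
  by rewrite hz; apply: le_lt_trans hr; rewrite ler_wpM2l// lerDl.
have := H _ hzr; rewrite scale0r addr0 add0r hz => {}H.
have -> : complex.Re (c * f (p + ((x + h)%:C * zeta) *: v)) -
    complex.Re (c * f (p + (x%:C * zeta) *: v)) - complex.Re (c * (zeta * d)) * h =
  complex.Re (c * (f (p + (x%:C * zeta) *: v + (h%:C * zeta) *: v) -
    f (p + (x%:C * zeta) *: v) - d * (h%:C * zeta))).
  rewrite rmorphD/= mulrDl scalerDl addrA -ReMR -!raddfB; congr complex.Re.
  by rewrite 2!mulrBr; congr (_ - _); rewrite -!mulrA; congr (_ * _); rewrite mulrCA (mulrC zeta).
apply: le_trans (le_Re_modulus _) _; rewrite modulusM.
apply: le_trans (ler_wpM2l (modulus_ge0 c) H) _.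
move: (modulus_ge0 c) (modulus_ge0 zeta) K0; move: (modulus c) (modulus zeta) => a b a0 b0 K0.
rewrite (_ : a * (e / (a * b + 1) * (`|h| * b)) = e * `|h| * (a * b / (a * b + 1))).
  by rewrite ler_piMr ?mulr_ge0 ?(ltW e0)// ler_pdivrMr// mul1r lerDl.
by ring.
Qed.

(** The [+ 1] covers [x = 0]; the quarter leaves room for two successive displacements inside the
    ball of radius [rho]. *)
Lemma modulus_scale_le (x : V) (z : C) (rho : R) : 0 < rho ->
  modulus z <= rho / (4 * (modulus x + 1)) -> modulus (z *: x) <= rho / 4.
Proof.
have x0 : 0 < modulus x + 1 by rewrite ltr_wpDl ?modulus_ge0.
move=> rho0 zr; rewrite modulusZ; apply: le_trans (ler_wpM2r (modulus_ge0 x) zr) _.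
move: (modulus x) x0 (modulus_ge0 x) => a x0 a0.
rewrite (_ : rho / (4 * (a + 1)) * a = rho / 4 * (a / (a + 1))).
  by rewrite ler_piMr ?divr_ge0 ?(ltW rho0)// ler_pdivrMr// mul1r lerDl.
by field; rewrite gt_eqF.
Qed.

(* By the Cauchy formula [D p u] is an average of [f] over circles of a radius that
   does not depend on [p], so it can be differentiated under the integral; the
   Cauchy estimate provides the dominating constant. *)
Lemma second_dirderiv f (D : V -> V -> C) w u v (rho M : R) : 0 < rho ->
  (forall p, modulus (p - w) < rho -> modulus (f p) <= M) ->
  (forall p, modulus (p - w) < rho -> dirderiv f p u (D p u) /\ dirderiv f p v (D p v)) ->
  exists X : C, forall c, 
   is_derive (0 : R) 1 (fun t : R => complex.Re (c * D (w + t%:C *: v) u))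
     (complex.Re (c * X)) /\
   is_derive (0 : R) 1 (fun t : R => complex.Re (c * D (w + (t%:C * 'i%C) *: v) u))
     (complex.Re (c * ('i%C * X))).
Proof.
move=> rho0 fM df.
have tp0 : 0 < pi *+ 2 :> R by rewrite mulrn_wgt0// pi_gt0.
have u0 : 0 < 4 * (modulus u + 1) by rewrite mulr_gt0// ltr_wpDl ?modulus_ge0.
have v0 : 0 < 4 * (modulus v + 1) by rewrite mulr_gt0// ltr_wpDl ?modulus_ge0.
pose r := rho / (4 * (modulus u + 1)); have r0 : 0 < r by rewrite divr_gt0.
pose s := rho / (4 * (modulus v + 1)); have s0 : 0 < s by rewrite divr_gt0.
have ru (z : C) : modulus z <= r -> modulus (z *: u) <= rho / 4 by exact: modulus_scale_le.
have sv (z : C) : modulus z <= s -> modulus (z *: v) <= rho / 4 by exact: modulus_scale_le.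
have bDv p : modulus (p - w) <= rho / 2 -> modulus (D p v) <= 4 * M / s.
  move=> pw; have inb (z : C) : modulus z <= s -> modulus (p + z *: v - w) < rho.
    move=> /sv zs; rewrite addrAC; apply: le_lt_trans (modulusD _ _) _; lra.
  apply: (@cauchy_estimate _ (fun z => f (p + z *: v))) => //.
  - by move=> z /inb /df[_ H]; exists (D (p + z *: v) v); exact: dirderiv_line.
  - by apply: (df p _).2; lra.
  - by move=> z /inb; exact: fM.
(* Up to a constant factor, [G] is the integrand after differentiation at [t = 0]; [S kappa] is the
   mean of the real part of [kappa * G]. *)
pose G y := (D (w + (r%:C * cis y) *: u) v - D w v) / (r%:C * cis y).
pose S kappa := (pi *+ 2)^-1 * circle_int (fun y => complex.Re (kappa * G y)).
suff key (c zeta : C) : modulus zeta = 1 ->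
    is_derive (0 : R) 1 (fun t : R => complex.Re (c * D (w + (t%:C * zeta) *: v) u)) (S (c * zeta)).
  have modi : modulus ('i%C : C) = 1.
    by rewrite /modulus normc_def/= expr0n/= add0r expr1n sqrtr1.
  (* Oddness of [S] is read off from the uniqueness of derivatives, without appeal to the
     integrability of [G]; [comb] obtains real linearity in the same spirit. *)
  have SN k : S (- k) = - S k.
    have K0 := key (- k) 1 (modulus1 R); have K1 := key k 1 (modulus1 R).
    rewrite !mulr1 in K0 K1.
    have E : (fun t : R => complex.Re (- k * D (w + (t%:C * 1) *: v) u)) =
        - (fun t : R => complex.Re (k * D (w + (t%:C * 1) *: v) u)).
      by apply/funext => t; rewrite mulNr raddfN.
    rewrite E in K0; have K2 := is_deriveN K1.
    by rewrite -[LHS](@derive_val _ _ _ _ _ _ _ K0) -[RHS](@derive_val _ _ _ _ _ _ _ K2).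
  have comb (zeta c : C) : modulus zeta = 1 ->
     is_derive (0 : R) 1 (fun t : R => complex.Re (c * D (w + (t%:C * zeta) *: v) u))
       (complex.Re c * S zeta - complex.Im c * S (- 'i%C * zeta)).
    move=> z1; have K1 := key 1 zeta z1; rewrite mul1r in K1.
    have K2 := key (- 'i%C) zeta z1.
    have := is_deriveB (is_deriveZ (complex.Re c) K1) (is_deriveZ (complex.Im c) K2).
    congr is_derive; apply/funext => t; rewrite !fctE /GRing.scale/= mul1r.
    move: (D _ _) => [d1 d2]; case: c => c1 c2; rewrite /GRing.scale/=; ring.
  (* The real part of [X] has to be [S 1], and its imaginary part, the real part of [- 'i * X], has
     to be [S (- 'i)]. *)
  exists (S 1 +i* S (- 'i%C)) => c; split.
    have := comb 1 c (modulus1 R); rewrite mulr1.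
    have -> : (fun t : R => complex.Re (c * D (w + (t%:C * 1) *: v) u)) =
      (fun t : R => complex.Re (c * D (w + t%:C *: v) u)).
      by apply/funext => t; rewrite mulr1.
    by case: c.
  have := comb 'i%C c modi; rewrite mulNr -expr2 sqr_i opprK.
  rewrite -[S 'i%C]opprK -SN; congr (is_derive _ _ _ _).
  by case: c => c1 c2 /=; ring.
move=> zeta1.
have tv (t : R) : `|t| < s -> modulus ((t%:C * zeta) *: v) <= rho / 4.
  by move=> ts; apply: sv; rewrite modulusM modulusR zeta1 mulr1 ltW.
pose F t := fun z => f ((w + (t%:C * zeta) *: v) + z *: u).
pose h t y := complex.Re (c * cauchy_quot (F t) r y).
pose h' t y := complex.Re (c * (zeta *
  ((D (w + (t%:C * zeta) *: v + (r%:C * cis y) *: u) v - D (w + (t%:C * zeta) *: v) v) / (r%:C * cis y)))).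
have dF t : `|t| < s -> forall z, modulus z <= r -> exists e, cderiv (F t) z e.
  move=> /tv ts z /ru zr; exists (D (w + (t%:C * zeta) *: v + z *: u) u).
  apply: dirderiv_line; apply: (df _ _).1.
  rewrite addrAC [w + _]addrC addrK.
  by apply: le_lt_trans (modulusD _ _) _; lra.
have inth t : `|t| < s -> mu.-integrable `[0, pi *+ 2] (EFin \o h t).
  move=> ts; apply: continuous_itv_integrable => y _.
  by apply: continuous_cauchy_quot => //; exact: dF.
have inI t : `]-s, s[%classic t = (`|t| < s) :> Prop.
  by rewrite /= in_itv/= ltr_norml.
have dh (t y : R) : `|t| < s -> is_derive t 1 (h ^~ y) (h' t y).
  move=> ts; set q := r%:C * cis y.
  have D1 := @dirderiv_real f (w + q *: u) v (D (w + (t%:C * zeta) *: v + q *: u) v) (c / q) zeta t.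
  have D2 := @dirderiv_real f w v (D (w + (t%:C * zeta) *: v) v) (c / q) zeta t.
  have tw : modulus (w + (t%:C * zeta) *: v - w) < rho.
    by rewrite addrAC subrr add0r; apply: le_lt_trans (tv t ts) _; lra.
  have tqw : modulus (w + (t%:C * zeta) *: v + q *: u - w) < rho.
    rewrite addrAC [w + _ - w]addrAC subrr add0r; apply: le_lt_trans (modulusD _ _) _.
    by have := tv t ts; have := ru q; rewrite modulus_rcis// => /(_ (lexx _)); lra.
  have {}D1 := D1 _. rewrite (addrAC w) in D1. have {}D1 := D1 (df _ tqw).2.
  have {}D2 := D2 (df _ tw).2.
  have -> : h ^~ y = (fun t => complex.Re (c / q * f (w + q *: u + (t%:C * zeta) *: v)))
      - (fun t => complex.Re (c / q * f (w + (t%:C * zeta) *: v))).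
    apply/funext => t'; rewrite !fctE /h /cauchy_quot /F -raddfB scale0r addr0 -/q (addrAC w).
    by congr complex.Re; rewrite -mulrBr [in RHS]mulrAC mulrA.
  have -> : h' t y = complex.Re (c / q * (zeta * D (w + (t%:C * zeta) *: v + q *: u) v))
     - complex.Re (c / q * (zeta * D (w + (t%:C * zeta) *: v) v)).
    rewrite /h' -raddfB -/q; congr complex.Re.
    by rewrite -2!mulrBr [in RHS]mulrAC !mulrA.
  exact: is_deriveB.
(* [bDv] bounds both terms in the numerator of [h'] by [4 * M / s], since two displacements of size
   [rho / 4] stay within [rho / 2]; the denominator has modulus [r]. *)
pose K := 2 * (modulus c * (4 * M / s) / r).
have hK (t y : R) : `|t| < s -> `|h' t y| <= K.
  move=> ts; apply: le_trans (le_Re_modulus _) _.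
  rewrite 3!modulusM modulusV modulus_rcis// zeta1 mul1r /K.
  rewrite (_ : 2 * _ = modulus c * ((4 * M / s + 4 * M / s) / r)); last by ring.
  rewrite ler_wpM2l ?modulus_ge0// ler_wpM2r ?invr_ge0 ?(ltW r0)//.
  apply: le_trans (modulusD _ _) _; rewrite modulusN; apply: lerD; apply: bDv.
    rewrite addrAC [w + _ - w]addrAC subrr add0r; apply: le_trans (modulusD _ _) _.
    by have := tv t ts; have := ru (r%:C * cis y); rewrite modulus_rcis// => /(_ (lexx _)); lra.
  by rewrite addrAC subrr add0r; apply: le_trans (tv t ts) _; lra.
have I0 : `](-s : R), s[%classic 0 by rewrite inI normr0.
have d1h (t y : R) : `|t| < s -> partial1of2 h t y = h' t y.
  by move=> ts; rewrite partial1of2E; have Dt := dh t y ts; exact: derive_val.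
have K0 : 0 <= K by apply: le_trans (hK 0 0 _); rewrite ?normr0.
have intK : mu.-integrable `[0, pi *+ 2] (EFin \o (fun=> K)).
  by apply: continuous_itv_integrable => y _; exact: cvg_cst.
have H1 : derivable (fun t => circle_int (h t)) 0 1.
  apply: (@derivable_under_integral _ _ _ mu h `[0, pi *+ 2]%classic _ 0 (-s) s I0 _ _ (fun=> K)) => //.
  - by move=> t; rewrite inI; exact: inth.
  - by move=> t y; rewrite inI => ts _; have [] := dh t y ts.
  - by move=> t y; rewrite inI => ts _; rewrite d1h// hK.
have H2 : 'D_1 (fun t => circle_int (h t)) 0 = circle_int (h' 0).
  rewrite -derive1E.
  have := @differentiation_under_integral _ _ _ mu h `[0, pi *+ 2]%classic
    (measurable_itv _) 0 (- s) s I0 _ _ (fun=> K).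
  move=> -> //.
  - by apply: eq_Rintegral => y _; rewrite d1h ?normr0.
  - by move=> t; rewrite inI; exact: inth.
  - by move=> t y; rewrite inI => ts _; have [] := dh t y ts.
  - by move=> t y; rewrite inI => ts _; rewrite d1h// hK.
have H3 : is_derive (0:R) 1 (fun t => (pi *+ 2)^-1 * circle_int (h t)) (S (c * zeta)).
  have := is_deriveZ (pi *+ 2)^-1 (DeriveDef H1 H2).
  congr is_derive; rewrite /S /GRing.scale/=; congr (_ * _).
  by apply: eq_Rintegral => y _; rewrite /h' /G mul0r scale0r addr0 mulrA.
(* For small [t] the Cauchy formula identifies the mean of [h t] with the real part of
   [c * D (w + (t%:C * zeta) *: v) u]. *)
apply: near_eq_is_derive H3.
apply/nbhs_ballP; exists s => // t; rewrite -ball_normE/= sub0r normrN => ts.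
have := @cauchy_deriv _ (fun z => c * F t z) r (c * D (w + (t%:C * zeta) *: v) u) r0.
have -> : (fun y => complex.Re (cauchy_quot (fun z => c * F t z) r y)) = h t.
  by apply/funext => y; rewrite /h /cauchy_quot -mulrBr mulrA.
move=> ->.
- by rewrite mulrC mulfK// gt_eqF.
- by move=> z /(dF t ts)[e He]; exists (c * e); exact: cderivZ.
- apply: cderivZ; apply: (df _ _).1.
  by rewrite addrAC subrr add0r; apply: le_lt_trans (tv t ts) _; lra.
Qed.

End osgood.

(** * The curvature in terms of [gamma] and its first derivatives *)

Section hilbert.
Variables (R : realType).
Local Notation C := R[i].
Variables (H : normedModType C) (dot : {dot H for Num.conj}).
Hypothesis hdot : forall x : H, `|x| ^+ 2 = dot x x.
Local Notation "''[' x , y ]" := (dot x y) : ring_scope.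

Lemma dotC x y : '[x, y] = ('[y, x])^*.
Proof. by rewrite hermC expr0 mul1r. Qed.

Lemma dotDl x y z : '[x + y, z] = '[x, z] + '[y, z].
Proof. exact: linearDl. Qed.
Lemma dotBl x y z : '[x - y, z] = '[x, z] - '[y, z].
Proof. exact: linearBl. Qed.
Lemma dotZl a x z : '[a *: x, z] = a * '[x, z].
Proof. exact: linearZl_LR. Qed.
Lemma dotDr x y z : '[z, x + y] = '[z, x] + '[z, y].
Proof. exact: linearDr. Qed.
Lemma dotBr x y z : '[z, x - y] = '[z, x] - '[z, y].
Proof. exact: linearBr. Qed.
Lemma dotZr a x z : '[z, a *: x] = a^* * '[z, x].
Proof. exact: linearZr_LR. Qed.

Lemma dot_modulus x : '[x, x] = (modulus x ^+ 2)%:C.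
Proof. by rewrite -hdot normE rmorphXn. Qed.

(** Cauchy-Schwarz: expand the square norm of [a *: x - '[x, y] *: y] with [a] the square norm of
    [y], and divide by [a]. *)
Lemma le_modulus_dot x y : modulus '[x, y] <= modulus x * modulus y.
Proof.
have [->|y0] := eqVneq y 0; first by rewrite linear0r !modulus0 mulr0.
have ym := modulus_gt0 y0; set a := modulus y ^+ 2.
have a0 : 0 < a by rewrite exprn_gt0.
have E : '[a%:C *: x - '[x, y] *: y, a%:C *: x - '[x, y] *: y] =
    (a * (a * modulus x ^+ 2 - modulus '[x, y] ^+ 2))%:C.
  rewrite dotBl !dotBr !dotZl !dotZr !dot_modulus -/a (dotC y x).
  have -> : (a%:C)^* = a%:C by exact: conjc_real.
  have RM (b c : R) : (b * c)%:C = b%:C * c%:C by exact: rmorphM.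
  have RB (b c : R) : (b - c)%:C = b%:C - c%:C by exact: rmorphB.
  have -> : (a * (a * modulus x ^+ 2 - modulus '[x, y] ^+ 2))%:C =
    a%:C * (a%:C * (modulus x ^+ 2)%:C - '[x, y] * ('[x, y])^*).
    by rewrite RM RB RM; congr (_ * (_ - _)); rewrite rmorphXn/= -normE sqr_normc.
  by move: ('[x, y]) (('[x, y])^*) ((modulus x ^+ 2)%:C) (a%:C) => ? ? ? ?; ring.
have : 0 <= a * (a * modulus x ^+ 2 - modulus '[x, y] ^+ 2).
  by rewrite -lecR -E dot_modulus lecR sqr_ge0.
rewrite pmulr_rge0// subr_ge0 -exprMn ler_pXn2r ?nnegrE ?mulr_ge0 ?modulus_ge0//.
by rewrite mulrC.
Qed.

Variable m : nat.
Local Notation V := 'rV[C]_m.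
Implicit Types (p v : V) (gamma : V -> H).

Lemma derivable_modulusP gamma p v : derivable gamma p v ->
  forall e : R, 0 < e -> exists2 r : R, 0 < r & forall z : C, modulus z < r ->
    modulus (gamma (p + z *: v) - gamma p - z *: 'D_v gamma p) <= e * modulus z.
Proof.
move=> dg e e0.
have cv : h^-1 *: (gamma (h *: v + p) - gamma p) @[h --> (0 : C)^'] --> 'D_v gamma p by exact: dg.
move/cvg_modulusP : cv => /(_ e e0).
rewrite near_withinE => /near0_modulusP[r r0 Hr]; exists r => // z zr.
have [->|z0] := eqVneq z 0.
  by rewrite !scale0r addr0 subrr subr0 !modulus0 mulr0.
have := Hr z zr z0; rewrite -(ler_pM2r (modulus_gt0 z0)); apply: le_trans.
rewrite mulrC -modulusZ scalerBr scalerA mulfV// scale1r -modulusN opprB.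
by rewrite (addrC p).
Qed.

Lemma dirderiv_dot gamma p v h : derivable gamma p v ->
  dirderiv (fun p => '[gamma p, h]) p v '['D_v gamma p, h].
Proof.
move=> dg; apply/cderiv_modulusP => e e0.
have h0 : 0 < modulus h + 1 by rewrite ltr_wpDl ?modulus_ge0.
have [|r r0 Hr] := derivable_modulusP dg (_ : 0 < e / (modulus h + 1)).
  by rewrite divr_gt0.
exists r => // z zr; rewrite scale0r addr0 add0r (mulrC _ z) -dotZl -!dotBl.
apply: le_trans (le_modulus_dot _ _) _.
apply: le_trans (ler_wpM2r (modulus_ge0 h) (Hr z zr)) _.
rewrite mulrAC (mulrAC e) ler_wpM2r ?modulus_ge0// -mulrA.
by rewrite ler_piMr ?(ltW e0)// ler_pdivrMr// mul1r lerDl.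
Qed.


Variables (gamma : V -> H) (Omega : set V) (oOmega : open Omega).
Hypothesis dgamma : forall p, Omega p -> differentiable gamma p.
Local Notation D p v := ('D_v gamma p).

Let derg p v : Omega p -> derivable gamma p v.
Proof. by move=> /dgamma; exact: diff_derivable. Qed.

Lemma open_modulusP p : Omega p ->
  exists2 rho : R, 0 < rho & forall q, modulus (q - p) < rho -> Omega q.
Proof.
move=> Op; have /nbhs_ballP[[d di] /=] : nbhs p Omega by exact: open_nbhs_nbhs.
rewrite ltcE/= => /andP[/eqP di0 d0] Hd; exists d => // q qp.
by apply: Hd; rewrite -ball_normE/= -normrN opprB normE ltcE/= di0 eqxx.
Qed.

Definition sqn p : R := complex.Re '[gamma p, gamma p].

(* [zeta] is meant to be [1] or ['i], the two real directions in the Wirtinger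
   derivatives. *)
Lemma derive_sqn p v (zeta : C) : Omega p ->
  is_derive (0 : R) 1 (fun t : R => sqn (p + (t%:C * zeta) *: v))
    (2 * complex.Re (zeta * '[D p v, gamma p])).
Proof.
move=> Op; apply: is_derive_eps => e e0.
(* [B] bounds the increment of [gamma] per unit of [h]; [A] collects the coefficients of [k] in the
   linear and the quadratic error. *)
pose B := modulus (zeta *: D p v) + modulus zeta + 1.
pose A := 2 * (modulus zeta * modulus (gamma p)) + B ^+ 2 + 1.
have B0 : 0 < B by rewrite ltr_wpDl// addr_ge0 ?modulus_ge0.
have A0 : 0 < A.
  by rewrite ltr_wpDl// addr_ge0 ?sqr_ge0 ?mulr_ge0 ?modulus_ge0.
pose k := Num.min 1 (e / A).
have k0 : 0 < k by rewrite lt_min ltr01 divr_gt0.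
have k1 : k <= 1 by rewrite ge_min lexx.
have kA : k * A <= e by rewrite -ler_pdivlMr// ge_min lexx orbT.
have [r r0 Hr] := derivable_modulusP (@derg p v Op) k0.
have z0 : 0 < modulus zeta + 1 by rewrite ltr_wpDl ?modulus_ge0.
exists (Num.min k (r / (modulus zeta + 1))); first by rewrite lt_min k0 divr_gt0.
move=> h; rewrite lt_min => /andP[hk]; rewrite ltr_pdivlMr// => hr.
have hz : modulus (h%:C * zeta) = `|h| * modulus zeta by rewrite modulusM modulusR.
have hzr : modulus (h%:C * zeta) < r.
  by rewrite hz; apply: le_lt_trans hr; rewrite ler_wpM2l// lerDl.
have := Hr _ hzr; rewrite hz add0r mul0r scale0r addr0.
set g1 := gamma (p + _); set g0 := gamma p; set E := g1 - g0 - _ => HE.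
have Eg : g1 - g0 = (h%:C * zeta) *: D p v + E by rewrite /E [in RHS]addrC subrK.
have -> : sqn (p + (h%:C * zeta) *: v) - sqn p - 2 * complex.Re (zeta * '[D p v, g0]) * h =
   2 * complex.Re '[E, g0] + modulus (g1 - g0) ^+ 2.
  have S : '[g1, g1] = '[g0, g0] + '[g1 - g0, g0] + ('[g1 - g0, g0])^* + '[g1 - g0, g1 - g0].
    by rewrite -dotC !dotBl !dotBr; ring.
  rewrite /sqn -/g1 -/g0 S (dot_modulus (g1 - g0)) Eg dotDl dotZl -Eg.
  have aux (x y n a : C) (b : R) : complex.Re (n + (h%:C * a * x + y) +
      (h%:C * a * x + y)^* + b%:C) - complex.Re n - 2 * complex.Re (a * x) * h =
      2 * complex.Re y + b.
    by case: x y n a => [x1 x2] [y1 y2] [n1 n2] [a1 a2] /=; ring.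
  exact: aux.
have H1 : `|complex.Re '[E, g0]| <= k * `|h| * (modulus zeta * modulus g0).
  apply: le_trans (le_Re_modulus _) _; apply: le_trans (le_modulus_dot _ _) _.
  by apply: le_trans (ler_wpM2r (modulus_ge0 g0) HE) _; rewrite !mulrA.
have H2 : modulus (g1 - g0) <= `|h| * B.
  rewrite Eg -scalerA; apply: le_trans (modulusD _ _) _.
  rewrite modulusZ modulusR; apply: le_trans (lerD (lexx _) HE) _.
  have : k * (`|h| * modulus zeta) <= 1 * (`|h| * modulus zeta).
    by rewrite ler_wpM2r// mulr_ge0// modulus_ge0.
  by have := normr_ge0 h; rewrite /B; move: (modulus (_ *: _)) => b; lra.
have H3 : modulus (g1 - g0) ^+ 2 <= k * `|h| * B ^+ 2.
  apply: (@le_trans _ _ ((`|h| * B) ^+ 2)).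
    by rewrite ler_pXn2r ?nnegrE ?modulus_ge0// mulr_ge0// ltW.
  by rewrite exprMn ler_wpM2r ?sqr_ge0// expr2 ler_wpM2r// ltW.
apply: le_trans (ler_normD _ _) _; rewrite normrM (ger0_norm (ler0n _ 2)) [`|_ ^+ 2|]ger0_norm ?sqr_ge0//.
have := ler_wpM2r (normr_ge0 h) kA; have := mulr_ge0 (ltW k0) (normr_ge0 h).
by move: H1 H3; rewrite /A -/g0; lra.
Qed.


Lemma sqn_gt0 p : gamma p != 0 -> 0 < sqn p.
Proof. by move=> g0; rewrite /sqn dot_modulus/= exprn_gt0// modulus_gt0. Qed.

Lemma real_deriveE (f : V -> C) v p (a b : R) :
  is_derive (0 : R) 1 (fun t : R => complex.Re (f (p + t%:C *: v))) a ->
  is_derive (0 : R) 1 (fun t : R => complex.Im (f (p + t%:C *: v))) b ->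
  real_derive f v p = a +i* b.
Proof.
by move=> Da Db; rewrite /real_derive !derive1E; congr (_ +i* _); exact: derive_val.
Qed.

Lemma real_derive_log_sqnorm p v (zeta : C) : Omega p -> gamma p != 0 ->
  real_derive (log_sqnorm gamma) (zeta *: v) p =
  (2 * complex.Re (zeta * '[D p v, gamma p]) / sqn p)%:C.
Proof.
move=> Op g0.
have Dn := derive_sqn v zeta Op.
have E (t : R) : log_sqnorm gamma (p + t%:C *: (zeta *: v)) =
    (ln (sqn (p + (t%:C * zeta) *: v)))%:C.
  by rewrite /log_sqnorm /sqn hdot scalerA.
apply: real_deriveE; last first.
  rewrite (_ : (fun t : R => _) = cst 0); first exact: is_derive_cst.
  by apply/funext => t; rewrite E.
rewrite (_ : (fun t : R => _) = @ln R \o (fun t : R => sqn (p + (t%:C * zeta) *: v))); last first.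
  by apply/funext => t; rewrite E.
rewrite mulrC; apply: is_derive1_comp.
rewrite mul0r scale0r addr0; apply: is_derive1_ln; exact: sqn_gt0.
Qed.

(** Writing [g] for ['[D p v, gamma p]], the two real derivatives combine by [Re g + i Re (i g)],
    which is the conjugate of [g]. *)
Lemma dwbar_log_sqnorm k p : Omega p -> gamma p != 0 ->
  dwbar k (log_sqnorm gamma) p =
  ('[D p (delta_mx 0 k), gamma p])^* / (sqn p)%:C.
Proof.
move=> Op g0; rewrite /dwbar -[X in real_derive _ X _ + _]scale1r.
rewrite !real_derive_log_sqnorm//.
rewrite mul1r -fmorphV/=; move: ('[_, _]) ((sqn p)^-1) => [x y] n.
apply: (mulfI (_ : 2 != 0 :> C)); first by rewrite pnatr_eq0.
rewrite mulrA mulfV ?pnatr_eq0// mul1r.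
by apply/eqP; rewrite eq_complex/=; apply/andP; split; apply/eqP; ring.
Qed.

(** Paired with [D p u] itself, the Cauchy estimate bounds the square of [modulus (D p u)] by
    [4 * M / s] times its first power. Halving [rho] leaves room for the discs. *)
Lemma locally_bounded_derive w u : Omega w -> exists (rho K M : R), [/\ 0 < rho,
  forall p, modulus (p - w) < rho -> Omega p,
  forall p, modulus (p - w) < rho -> modulus (gamma p) <= M &
  forall p, modulus (p - w) < rho -> modulus (D p u) <= K].
Proof.
move=> Ow; have [rho1 rho10 H1] := open_modulusP Ow.
have [rho2 rho20 H2] : exists2 rho : R, 0 < rho & forall q, modulus (q - w) < rho ->
    modulus (gamma q) <= modulus (gamma w) + 1.
  have /cvg_modulusP/(_ 1 ltr01) := differentiable_continuous (dgamma Ow).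
  move=> /nbhs_ballP[[d di] /=]; rewrite ltcE/= => /andP[/eqP di0 d0] Hd; exists d => // q qw.
  have /= := Hd q; rewrite -ball_normE/= -normrN opprB normE ltcE/= di0 eqxx => /(_ qw) le1.
  rewrite -[gamma q](subrK (gamma w)) addrC; apply: le_trans (modulusD _ _) _.
  by rewrite lerD2l -modulusN opprB.
pose rho := Num.min rho1 rho2; have rho0 : 0 < rho by rewrite lt_min rho10.
pose M := modulus (gamma w) + 1; pose s := rho / (4 * (modulus u + 1)).
have s0 : 0 < s by rewrite divr_gt0// mulr_gt0// ltr_wpDl ?modulus_ge0.
have HO p : modulus (p - w) < rho -> Omega p by rewrite lt_min => /andP[/H1].
have HM p : modulus (p - w) < rho -> modulus (gamma p) <= M by rewrite lt_min => /andP[_ /H2].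
exists (rho / 2), (4 * M / s), M; split.
- by rewrite divr_gt0.
- by move=> p pw; apply: HO; lra.
- by move=> p pw; apply: HM; lra.
move=> p pw; have inb (z : C) : modulus z <= s -> modulus (p + z *: u - w) < rho.
  move=> /(modulus_scale_le rho0) zs; rewrite addrAC.
  by apply: le_lt_trans (modulusD _ _) _; lra.
have := @cauchy_estimate _ (fun z => '[gamma (p + z *: u), D p u]) s (M * modulus (D p u))
  '[D p u, D p u] s0.
have -> : modulus '[D p u, D p u] = modulus (D p u) * modulus (D p u).
  by rewrite dot_modulus modulusR ger0_norm ?sqr_ge0.
move=> CE; have {CE} : modulus (D p u) * modulus (D p u) <= 4 * (M * modulus (D p u)) / s.
  apply: CE.
  - move=> z /inb /HO Oz; exists '[D (p + z *: u) u, D p u].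
    exact: (@dirderiv_line _ _ (fun q => '[gamma q, D p u])) (dirderiv_dot _ (derg Oz)).
  - by apply: dirderiv_dot; apply: derg; apply: HO; lra.
  - move=> z /inb zw; apply: le_trans (le_modulus_dot _ _) _.
    by rewrite ler_wpM2r ?modulus_ge0// HM.
have [->|/modulus_gt0 d0] := eqVneq (D p u) 0.
  by rewrite modulus0 divr_ge0 ?(ltW s0)// mulr_ge0// addr_ge0// modulus_ge0.
by rewrite mulrA mulrAC ler_pM2r.
Qed.


Lemma modulus_le_parts (z : C) : modulus z <= `|complex.Re (1 * z)| + `|complex.Re (- 'i%C * z)|.
Proof.
apply: le_trans (modulus_le z) _; rewrite mul1r lerD2l.
by case: z => a b /=; rewrite oppr0 mul0r sub0r mulN1r opprK.
Qed.

(* Strong times weak: the second factor is differentiable in norm, and the first,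
   being bounded, only weakly. *)
Lemma derive_dot_product (F G : R -> H) (d g : H) (K : R) (X : C) :
  F 0 = d -> (\forall t \near (0 : R), modulus (F t) <= K) ->
  (forall e : R, 0 < e -> exists2 r : R, 0 < r & forall t : R, `|t| < r ->
     modulus (G t - G 0 - t%:C *: g) <= e * `|t|) ->
  (forall c : C, is_derive (0 : R) 1 (fun t : R => complex.Re (c * '[F t, G 0]))
     (complex.Re (c * X))) ->
  (forall c : C, exists l : R,
     is_derive (0 : R) 1 (fun t : R => complex.Re (c * '[F t, g])) l) ->
  forall c : C, is_derive (0 : R) 1 (fun t : R => complex.Re (c * '[F t, G t]))
    (complex.Re (c * (X + '[d, g]))).
Proof.
move=> Fd FK Gg FX Fg c.
(* Weak differentiability against [g] implies weak continuity against [g]. *)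
have cont : forall e : R, 0 < e -> exists2 r : R, 0 < r & forall t : R, `|t| < r ->
    modulus '[F t - d, g] <= e.
  move=> e e0; have [l1 L1] := Fg 1; have [l2 L2] := Fg (- 'i%C).
  have [r1 r10 H1] := derive_eps L1 ltr01; have [r2 r20 H2] := derive_eps L2 ltr01.
  pose A := `|l1| + `|l2| + 2; have A0 : 0 < A by rewrite ltr_wpDl// addr_ge0.
  exists (Num.min (e / A) (Num.min r1 r2)); first by rewrite !lt_min r10 r20 divr_gt0.
  move=> t; rewrite !lt_min => /and3P[te t1 t2].
  apply: le_trans (modulus_le_parts _) _; rewrite dotBl -Fd !mulrBr !raddfB/=.
  have := H1 t t1; have := H2 t t2; rewrite !add0r.
  set a := complex.Re (1 * _) - _; set b := complex.Re (_ * _) - _ => B1 B2.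
  have b1 : `|a| <= (1 + `|l1|) * `|t|.
    rewrite mulrDl -normrM -[a](subrK (l1 * t)).
    by apply: le_trans (ler_normD _ _) _; rewrite lerD2r.
  have b2 : `|b| <= (1 + `|l2|) * `|t|.
    rewrite mulrDl -normrM -[b](subrK (l2 * t)).
    by apply: le_trans (ler_normD _ _) _; rewrite lerD2r.
  move: te; rewrite ltr_pdivlMr// /A; lra.
have K0 : 0 <= K.
  by have := nbhs_singleton FK; apply: le_trans; exact: modulus_ge0.
have -> : (fun t : R => complex.Re (c * '[F t, G t])) =
    (fun t : R => complex.Re (c * '[F t, G 0])) + (fun t : R => complex.Re (c * '[F t, G t - G 0])).
  by apply/funext => t; rewrite !fctE -raddfD -mulrDr -dotDr addrC subrK.
rewrite mulrDr raddfD; apply: is_deriveD.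
apply: is_derive_eps => e e0.
have c0 : 0 < modulus c + 1 by rewrite ltr_wpDl ?modulus_ge0.
pose k := e / ((modulus c + 1) * (K + 1)).
have K1 : 0 < K + 1 by rewrite ltr_wpDl.
have k0 : 0 < k by rewrite divr_gt0// mulr_gt0.
have kE : (modulus c + 1) * (k * (K + 1)) = e by rewrite /k; field; rewrite !gt_eqF.
move/nbhs_ballP : FK => [r1 /= r10 H1].
have [r2 r20 H2] := Gg k k0; have [r3 r30 H3] := cont k k0.
exists (Num.min r1 (Num.min r2 r3)); first by rewrite !lt_min r10 r20.
move=> t; rewrite !lt_min => /and3P[t1 t2 t3]; rewrite add0r subrr linear0r mulr0 subr0.
have := H1 t; rewrite /ball/= sub0r normrN => /(_ t1) {}H1.
(* The first term is small because [F] is bounded and [G] differentiable in norm, the second by the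
   weak continuity [cont]. *)
have -> : complex.Re (c * '[F t, G t - G 0]) - complex.Re (c * '[d, g]) * t =
    complex.Re (c * ('[F t, G t - G 0 - t%:C *: g] + '[F t - d, g] * t%:C)).
  rewrite -ReMR -raddfB; congr complex.Re; rewrite dotBl [in RHS]dotBr dotZr (_ : (t%:C)^* = t%:C).
    ring.
  exact: conjc_real.
apply: le_trans (le_Re_modulus _) _; rewrite modulusM -kE.
have P1 : modulus '[F t, G t - G 0 - t%:C *: g] <= K * (k * `|t|).
  apply: le_trans (le_modulus_dot _ _) _; rewrite ler_pM ?modulus_ge0//; exact: H2.
have P2 : modulus ('[F t - d, g] * t%:C) <= k * `|t|.
  by rewrite modulusM modulusR ler_wpM2r//; exact: H3.
rewrite -mulrA ler_pM ?modulus_ge0//; first by rewrite lerDl.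
by apply: le_trans (modulusD _ _) _; lra.
Qed.

(* [X] is the second derivative of [gamma] paired with [gamma w]; it is the same in
   both directions, which is why it cancels in [wirtinger_combine]. *)
Lemma derive_dot_derive w u v : Omega w ->
  exists X Y : C, Y = - 'i%C * '[D w u, D w v] /\ forall c : C,
  is_derive (0 : R) 1
    (fun t : R => complex.Re (c * '[D (w + t%:C *: v) u, gamma (w + t%:C *: v)]))
    (complex.Re (c * (X + '[D w u, D w v]))) /\
  is_derive (0 : R) 1
    (fun t : R => complex.Re (c * '[D (w + (t%:C * 'i%C) *: v) u,
                                    gamma (w + (t%:C * 'i%C) *: v)]))
    (complex.Re (c * ('i%C * X + Y))).
Proof.
move=> Ow; have [rho [K [M [rho0 HO HM HK]]]] := locally_bounded_derive u Ow.
have sd h := @second_dirderiv _ _ (fun p => '[gamma p, h]) (fun p x => '[D p x, h]) w u v rho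
  (M * modulus h) rho0.
have {}sd h : exists X : C, forall c : C,
   is_derive (0 : R) 1 (fun t : R => complex.Re (c * '[D (w + t%:C *: v) u, h])) (complex.Re (c * X))
   /\ is_derive (0 : R) 1 (fun t : R => complex.Re (c * '[D (w + (t%:C * 'i%C) *: v) u, h]))
      (complex.Re (c * ('i%C * X))).
  apply: sd => p pw.
    by apply: le_trans (le_modulus_dot _ _) _; rewrite ler_wpM2r ?modulus_ge0// HM.
  by split; apply: dirderiv_dot; apply: derg; exact: HO.
(* Besides [gamma w], the test vectors are the velocities of [gamma] along [v] and ['i *: v], as
   [derive_dot_product] requires. *)
have [X HX] := sd (gamma w); have [Y HY] := sd (D w v).
have [Z HZ] := sd ('i%C *: D w v).
have near_line (zeta : C) : \forall t \near (0 : R), modulus (D (w + (t%:C * zeta) *: v) u) <= K.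
  pose A := modulus zeta * modulus v + 1.
  have A0 : 0 < A by rewrite ltr_wpDl// mulr_ge0 ?modulus_ge0.
  apply/nbhs_ballP; exists (rho / A) => /=; first by rewrite divr_gt0.
  move=> t; rewrite -ball_normE/= sub0r normrN ltr_pdivlMr// => tr.
  apply: HK; rewrite addrAC subrr add0r modulusZ modulusM modulusR.
  by apply: le_lt_trans tr; rewrite -mulrA ler_wpM2l// lerDl.
have gline (zeta : C) (e : R) : 0 < e -> exists2 r : R, 0 < r & forall t : R, `|t| < r ->
    modulus (gamma (w + (t%:C * zeta) *: v) - gamma w - t%:C *: (zeta *: D w v)) <= e * `|t|.
  move=> e0; have A0 : 0 < modulus zeta + 1 by rewrite ltr_wpDl ?modulus_ge0.
  have [|r r0 Hr] := derivable_modulusP (@derg w v Ow) (_ : 0 < e / (modulus zeta + 1)).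
    by rewrite divr_gt0.
  exists (r / (modulus zeta + 1)); first by rewrite divr_gt0.
  move=> t; rewrite ltr_pdivlMr// => tr.
  have mt : modulus (t%:C * zeta) = `|t| * modulus zeta by rewrite modulusM modulusR.
  have := Hr (t%:C * zeta); rewrite mt scalerA => H1.
  apply: le_trans (H1 _) _; first by apply: le_lt_trans tr; rewrite ler_wpM2l// lerDl.
  rewrite mulrCA mulrC ler_wpM2r// -mulrA ler_piMr ?(ltW e0)//.
  by rewrite mulrC ler_pdivrMr// mul1r lerDl.
exists X, '[D w u, 'i%C *: D w v]; split.
  rewrite [LHS](dotZr 'i%C (D w v) (D w u)); congr (_ * _).
  by apply/eqP; rewrite eq_complex/= oppr0 !eqxx.
move=> c; split.
  apply: (@derive_dot_product (fun t => D (w + t%:C *: v) u) (fun t => gamma (w + t%:C *: v)) _ _ K) => //.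
  - by rewrite scale0r addr0.
  - by have := near_line 1; apply: filterS => t; rewrite mulr1.
  - move=> e /(gline 1)[r r0 Hr]; exists r => // t tr.
    by have := Hr t tr; rewrite mulr1 !scale1r scale0r addr0.
  - by move=> c'; rewrite scale0r addr0; exact: (HX c').1.
  - by move=> c'; eexists; exact: (HY c').1.
apply: (@derive_dot_product (fun t => D (w + (t%:C * 'i%C) *: v) u)
  (fun t => gamma (w + (t%:C * 'i%C) *: v)) _ _ K) => //.
- by rewrite mul0r scale0r addr0.
- move=> e /(gline 'i%C)[r r0 Hr]; exists r => // t tr.
  by have := Hr t tr; rewrite mul0r scale0r addr0.
- by move=> c'; rewrite mul0r scale0r addr0; exact: (HX c').2.
- by move=> c'; eexists; exact: (HZ c').2.
Qed.


(** The real and imaginary parts of the conjugate of [S] are those of the form [Re (c * S)] with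
    [c = 1] and [c = 'i]; the quotient rule applies to each. *)
Lemma real_derive_conj_quot (f : V -> C) x w (S : R -> C) (N : R -> R) (S' : C) (N' : R) :
  (\forall t \near (0 : R), f (w + t%:C *: x) = (S t)^* / (N t)%:C) -> N 0 != 0 ->
  (forall c : C, is_derive (0 : R) 1 (fun t : R => complex.Re (c * S t)) (complex.Re (c * S'))) ->
  is_derive (0 : R) 1 N N' ->
  real_derive f x w = S'^* / (N 0)%:C - (S 0)^* * N'%:C / ((N 0)%:C ^+ 2).
Proof.
move=> fE N0 dS dN.
have quot (c : C) : is_derive (0 : R) 1 (fun t : R => complex.Re (c * S t) * (N t)^-1)
    (complex.Re (c * S') / N 0 - complex.Re (c * S 0) * N' / N 0 ^+ 2).
  have := is_deriveM (dS c) (is_deriveV N0 dN).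
  by congr is_derive; rewrite /GRing.scale/=; ring.
have -> : S'^* / (N 0)%:C - (S 0)^* * N'%:C / ((N 0)%:C ^+ 2) =
    (complex.Re (1 * S') / N 0 - complex.Re (1 * S 0) * N' / N 0 ^+ 2) +i*
    (complex.Re ('i%C * S') / N 0 - complex.Re ('i%C * S 0) * N' / N 0 ^+ 2).
  have aux (s s' : C) (a b n : R) : s'^* * a%:C - s^* * n%:C * b%:C =
    (complex.Re (1 * s') * a - complex.Re (1 * s) * n * b) +i*
    (complex.Re ('i%C * s') * a - complex.Re ('i%C * s) * n * b).
    case: s s' => [s1 s2] [s3 s4].
    by apply/eqP; rewrite eq_complex/=; apply/andP; split; apply/eqP; ring.
  by rewrite -aux !fmorphV/= rmorphXn.
apply: real_deriveE; apply: near_eq_is_derive (quot _).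
  apply: filterS fE => t ->; rewrite -fmorphV/=.
  by case: (S t) => a b /=; ring.
apply: filterS fE => t ->; rewrite -fmorphV/=.
by case: (S t) => a b /=; ring.
Qed.

(** The conjugate of [X] is the antiholomorphic contribution, killed by [d/dw] since
    [(- i) (- i) = - 1]; the sign of [- 'i * d] makes the two copies of the conjugate of [d] add up
    instead. *)
Lemma wirtinger_combine (X d s g : C) (n : R) :
  2^-1 * ((X + d)^* / n%:C - s^* * (2 * complex.Re (1 * g))%:C / n%:C ^+ 2 -
    'i%C * (('i%C * X + - 'i%C * d)^* / n%:C -
      s^* * (2 * complex.Re ('i%C * g))%:C / n%:C ^+ 2)) =
  d^* / n%:C - g * s^* / n%:C ^+ 2.
Proof.
apply: (mulfI (_ : 2 != 0 :> C)); first by rewrite pnatr_eq0.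
rewrite mulrA mulfV ?pnatr_eq0// mul1r -rmorphXn -!fmorphV/=.
move: n^-1 (n ^- 2) => a b; case: d s g X => [d1 d2] [s1 s2] [g1 g2] [x1 x2].
by apply/eqP; rewrite eq_complex/=; apply/andP; split; apply/eqP; ring.
Qed.

Lemma dw_dwbar_log_sqnorm i j w : (forall p, Omega p -> gamma p != 0) -> Omega w ->
  let Di := D w (delta_mx 0 i) in let Dj := D w (delta_mx 0 j) in
  dw i (dwbar j (log_sqnorm gamma)) w =
  '[Di, Dj] / (sqn w)%:C - '[Di, gamma w] * '[gamma w, Dj] / (sqn w)%:C ^+ 2.
Proof.
move=> g0 Ow; set v := delta_mx 0 i; set u := delta_mx 0 j => /=.
have [X [Y [Yd HX]]] := derive_dot_derive u v Ow.
have [rho rho0 HO] := open_modulusP Ow.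
have nearO (zeta : C) : \forall t \near (0 : R), Omega (w + (t%:C * zeta) *: v).
  pose A := modulus zeta * modulus v + 1.
  have A0 : 0 < A by rewrite ltr_wpDl// mulr_ge0 ?modulus_ge0.
  apply/nbhs_ballP; exists (rho / A) => /=; first by rewrite divr_gt0.
  move=> t; rewrite -ball_normE/= sub0r normrN ltr_pdivlMr// => tr.
  apply: HO; rewrite addrAC subrr add0r modulusZ modulusM modulusR.
  by apply: le_lt_trans tr; rewrite -mulrA ler_wpM2l// lerDl.
have N0 : sqn w != 0 by rewrite gt_eqF// sqn_gt0// g0.
have E1 : real_derive (dwbar j (log_sqnorm gamma)) v w =
    (X + '[D w u, D w v])^* / (sqn w)%:C -
    ('[D w u, gamma w])^* * (2 * complex.Re (1 * '[D w v, gamma w]))%:C / (sqn w)%:C ^+ 2.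
  have := @real_derive_conj_quot (dwbar j (log_sqnorm gamma)) v w
    (fun t => '[D (w + t%:C *: v) u, gamma (w + t%:C *: v)])
    (fun t => sqn (w + t%:C *: v)) (X + '[D w u, D w v]) (2 * complex.Re (1 * '[D w v, gamma w])).
  rewrite scale0r addr0; apply => //.
  - apply: filterS (nearO 1) => t; rewrite mulr1 => Ot.
    by rewrite dwbar_log_sqnorm// g0.
  - by move=> c; exact: (HX c).1.
  - have Hs := @derive_sqn w v 1 Ow.
    rewrite (_ : (fun t : R => _) = (fun t : R => sqn (w + t%:C *: v))) in Hs; first exact Hs.
    by apply/funext => t; rewrite mulr1.
have E2 : real_derive (dwbar j (log_sqnorm gamma)) ('i%C *: v) w =
    ('i%C * X + Y)^* / (sqn w)%:C -
    ('[D w u, gamma w])^* * (2 * complex.Re ('i%C * '[D w v, gamma w]))%:C / (sqn w)%:C ^+ 2.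
  have := @real_derive_conj_quot (dwbar j (log_sqnorm gamma)) ('i%C *: v) w
    (fun t => '[D (w + (t%:C * 'i%C) *: v) u, gamma (w + (t%:C * 'i%C) *: v)])
    (fun t => sqn (w + (t%:C * 'i%C) *: v)) ('i%C * X + Y)
    (2 * complex.Re ('i%C * '[D w v, gamma w])).
  rewrite mul0r scale0r addr0; apply => //.
  - apply: filterS (nearO 'i%C) => t Ot.
    by rewrite scalerA dwbar_log_sqnorm// g0.
  - by move=> c; exact: (HX c).2.
  - have Hs := @derive_sqn w v 'i%C Ow; exact Hs.
rewrite /dw -/v E1 E2 Yd; apply: etrans (wirtinger_combine _ _ _ _ _) _.
by congr (_ / _ - _ * _ / _); exact/esym/dotC.
Qed.

Lemma curvatureE i j w : (forall p, Omega p -> gamma p != 0) -> Omega w ->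
  let Di := D w (delta_mx 0 i) in let Dj := D w (delta_mx 0 j) in
  - curvature gamma w i j =
  '[Di, Dj] / (sqn w)%:C - '[Di, gamma w] * '[gamma w, Dj] / (sqn w)%:C ^+ 2.
Proof. by move=> g0 Ow /=; rewrite !mxE opprK dw_dwbar_log_sqnorm. Qed.

(** Bookkeeping for [shift_op_derive]: [a] and [b] are the displaced and original values of [gamma],
    [d] its derivative, [Td] the image of [d], [q] the coordinate [w 0 j] and [l] the Kronecker
    delta. *)
Lemma shift_quotient_identity (L : lmodType C) (z q l : C) (a b d Td : L) :
  z *: (Td - q *: d - l *: b) =
  z *: (l *: (a - b)) - ((q + z * l) *: a - q *: b - z *: Td - q *: (a - b - z *: d)).
Proof.
rewrite !scalerBr scalerDl !scalerA (mulrC q z).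
move: (z *: Td) ((z * q) *: d) ((z * l) *: b) ((z * l) *: a) (q *: a) (q *: b).
move=> x1 x2 x3 x4 x5 x6.
have -> : x5 + x4 - x6 - x1 - (x5 - x6 - x2) = x4 - x1 + x2.
  have -> : x5 + x4 - x6 - x1 = x4 - x1 + (x5 - x6).
    by rewrite [x5 + x4]addrC -!addrA; congr (_ + _); rewrite addrA addrC.
  by rewrite opprB addrA addrAC addrK.
rewrite opprD addrA opprB (_ : x4 - x3 + (x1 - x4) = x1 - x3); first by rewrite addrAC.
by rewrite addrC addrA subrK.
Qed.

(** Apply [T j] to the first-order expansion of [gamma], using the eigenvector equation at [w] and
    at the displaced point. Boundedness of [T j] controls the image of the error [E], so the defect
    [Y] is smaller than any positive bound. *)
Lemma shift_op_derive (T : 'I_m -> {linear H -> H}) w j k :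
  (exists M : R, forall h, `|T j h| <= M%:C * `|h|) ->
  (forall p, Omega p -> joint_ker T p (gamma p)) -> Omega w ->
  shift_op T w j (D w (delta_mx 0 k)) = (j == k)%:R *: gamma w.
Proof.
move=> [M TM] kerT Ow; set v := delta_mx 0 k.
have {}TM h : modulus (T j h) <= M * modulus h.
  by rewrite -lecR rmorphM/= -!normE.
pose Y := shift_op T w j (D w v) - (j == k)%:R *: gamma w.
suff : Y = 0 by move/eqP; rewrite subr_eq0 => /eqP.
have [rho rho0 HO] := open_modulusP Ow.
(* [B] exceeds the sum of the coefficients of [e] in the final estimate of [modulus Y], so
   [e * (2 * B) <= modulus Y] is contradictory. *)
pose B := `|M| + modulus (w 0 j) + modulus (D w v) + 2.
have B0 : 0 < B by rewrite ltr_wpDl// !addr_ge0 ?modulus_ge0.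
have [//|/modulus_gt0 Y0] := eqVneq Y 0.
pose e := Num.min 1 (modulus Y / (2 * B)).
have e0 : 0 < e by rewrite lt_min ltr01 divr_gt0// mulr_gt0.
have e1 : e <= 1 by rewrite ge_min lexx.
have eB : e * (2 * B) <= modulus Y by rewrite -ler_pdivlMr ?mulr_gt0// ge_min lexx orbT.
have [r r0 Hr] := derivable_modulusP (@derg w v Ow) e0.
pose s := Num.min (e / 2) (Num.min (r / 2) (rho / (4 * (modulus v + 1)))).
have s0 : 0 < s.
  by rewrite !lt_min !divr_gt0// mulr_gt0// ltr_wpDl ?modulus_ge0.
have [se [sr sv]] : s <= e / 2 /\ s <= r / 2 /\ s <= rho / (4 * (modulus v + 1)).
  by rewrite !ge_min !lexx !orbT.
pose z : C := s%:C; have ms : modulus z = s by rewrite modulusR gtr0_norm.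
have Oz : Omega (w + z *: v).
  apply: HO; rewrite addrAC subrr add0r.
  apply: le_lt_trans (modulus_scale_le rho0 _) _; first by rewrite ms.
  lra.
set E := gamma (w + z *: v) - gamma w - z *: D w v.
have HE : modulus E <= e * s by have := Hr z; rewrite ms; apply; lra.
have K0 : T j (gamma w) = w 0 j *: gamma w.
  by apply/eqP; rewrite -subr_eq0; apply/eqP; exact: kerT.
have K1 : T j (gamma (w + z *: v)) = (w 0 j + z * (j == k)%:R) *: gamma (w + z *: v).
  apply/eqP; rewrite -subr_eq0; apply/eqP; have := kerT _ Oz j.
  by rewrite /shift_op !mxE eqxx.
have EY : z *: Y = z *: ((j == k)%:R *: (gamma (w + z *: v) - gamma w)) - (T j E - w 0 j *: E).
  have -> : T j E = (w 0 j + z * (j == k)%:R) *: gamma (w + z *: v) - w 0 j *: gamma w -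
      z *: T j (D w v) by rewrite -K1 -K0 /E 2!linearB linearZ.
  exact: shift_quotient_identity.
have nd : modulus ((j == k)%:R : C) <= 1.
  by case: eqP => _; rewrite ?modulus1 ?modulus0.
have H1 : modulus (gamma (w + z *: v) - gamma w) <= s * modulus (D w v) + e * s.
  rewrite -[_ - _](subrK (z *: D w v)) addrC; apply: le_trans (modulusD _ _) _.
  by rewrite modulusZ ms lerD2l.
have H2 : s * modulus Y <= s * (s * modulus (D w v) + e * s) +
    (`|M| * (e * s) + modulus (w 0 j) * (e * s)).
  rewrite -{1}ms -modulusZ EY; apply: le_trans (modulusD _ _) _; rewrite modulusN.
  apply: lerD.
    rewrite modulusZ ms ler_wpM2l ?(ltW s0)// modulusZ.
    apply: le_trans H1; rewrite -[leRHS]mul1r ler_wpM2r ?modulus_ge0//.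
  apply: le_trans (modulusD _ _) _; rewrite modulusN modulusZ.
  apply: lerD; last by rewrite ler_wpM2l ?modulus_ge0.
  apply: le_trans (TM E) _; apply: le_trans (ler_wpM2r (modulus_ge0 E) (ler_norm M)) _.
  by rewrite ler_wpM2l.
have H3 : modulus Y <= s * modulus (D w v) + e * s + (`|M| * e + modulus (w 0 j) * e).
  rewrite -(ler_pM2l s0); apply: le_trans H2 _.
  by rewrite le_eqVlt; apply/orP; left; apply/eqP; ring.
have H4 : s * modulus (D w v) <= e * modulus (D w v).
  by rewrite ler_wpM2r ?modulus_ge0//; lra.
have H5 : e * s <= e * 1 by rewrite ler_wpM2l ?(ltW e0)//; lra.
by exfalso; move: eB; rewrite /B; lra.
Qed.

End hilbert.

(** * The nilpotent operators *)

Section rank_one.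
Variables (R : realType).
Local Notation C := R[i].
Variables (H : normedModType C) (dot : {dot H for Num.conj}).
Local Notation "''[' x , y ]" := (dot x y) : ring_scope.

Lemma dot_suml (I : finType) (F : I -> H) z : '[\sum_i F i, z] = \sum_i '[F i, z].
Proof. exact: linear_sumlz. Qed.

Lemma dot_sumr (I : finType) (F : I -> H) z : '[z, \sum_i F i] = \sum_i '[z, F i].
Proof. exact: linear_sumr. Qed.

Lemma basis_mem n (V : set H) (b : 'I_n -> H) (c : 'I_n -> C) :
  is_basis V b -> V (\sum_i c i *: b i).
Proof. by case=> _ ->; exists c. Qed.

Lemma basis_vect_mem n (V : set H) (b : 'I_n -> H) i : is_basis V b -> V (b i).
Proof.
move=> hb; have := basis_mem (fun j => (j == i)%:R) hb.
rewrite (bigD1 i)//= eqxx scale1r big1 ?addr0// => j /negbTE ->.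
by rewrite scale0r.
Qed.

Lemma basis_coord n (V : set H) (b : 'I_n -> H) x : is_basis V b -> V x ->
  exists c, x = \sum_i c i *: b i.
Proof. by case=> _ ->. Qed.

(** [trace_on] chooses among the values given by all bases, so the trace is computed in an arbitrary
    one: expanding one factor of ['[e0, e0] = 1] in it gives [tau]. *)
Lemma trace_on_rank_one n (V : set H) (b : 'I_n -> H) (f : H -> H) e0 tau :
  is_basis V b -> V e0 -> '[e0, e0] = 1 ->
  (forall y, V y -> f y = (tau * '[y, e0]) *: e0) -> trace_on V f = tau.
Proof.
move=> hb Ve0 e01 fE.
have trE n' (b' : 'I_n' -> H) (eps : 'I_n' -> C) : e0 = \sum_i eps i *: b' i ->
    \sum_i tau * '[b' i, e0] * eps i = tau.
  move=> eE; rewrite -[RHS]mulr1 -e01 {2}eE dot_suml mulr_sumr.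
  by apply: eq_bigr => i _; rewrite dotZl mulrA [in RHS]mulrAC.
apply: xget_unique.
  have [eps eE] := basis_coord hb Ve0.
  exists n, b, (\matrix_(i, j) (tau * '[b j, e0] * eps i)); split => //.
    move=> j; rewrite fE; last exact: basis_vect_mem hb.
    rewrite {2}eE scaler_sumr; apply: eq_bigr => i _; by rewrite mxE scalerA.
  by rewrite /mxtrace -[LHS](trE _ _ _ eE); apply: eq_bigr => i _; rewrite mxE.
move=> t [n' [b' [M [hb' hM ->]]]].
have [eps eE] := basis_coord hb' Ve0.
rewrite /mxtrace -[RHS](trE _ _ _ eE); apply: eq_bigr => i _.
(* Linear independence of [b'] determines the column of [M] from the image of [b' i]. *)
apply/eqP; rewrite -subr_eq0; apply/eqP.
apply: (hb'.1 (fun k => M k i - tau * '[b' i, e0] * eps k)).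
under eq_bigr do rewrite scalerBl; rewrite sumrB -hM fE; last exact: basis_vect_mem hb'.
rewrite {2}eE scaler_sumr; apply/eqP; rewrite subr_eq0; apply/eqP.
by apply: eq_bigr => k _; rewrite scalerA.
Qed.

Lemma dot_eq0 x : '[x, x] = 0 -> x = 0.
Proof. by move=> x0; apply/eqP; rewrite -(dnorm_eq0 dot) x0. Qed.

(** At a point of [V], two adjoints differ by a vector of [V] orthogonal to [V], hence to itself;
    off [V] both vanish. So they agree as functions, as the choice in [adjoint_on] demands. *)
Lemma adjoint_on_unique (V : set H) (f g : H -> H) :
  (forall x y, V x -> V y -> V (x - y)) ->
  (forall y, V y -> V (g y)) -> (forall y, ~ V y -> g y = 0) ->
  (forall x y, V x -> V y -> '[f x, y] = '[x, g y]) -> adjoint_on dot V f = g.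
Proof.
move=> VB Vg g0 gP; apply: xget_unique; first by split.
move=> g' [Vg' g'0 g'P]; apply/funext => y; have [Vy|nVy] := pselect (V y); last first.
  by rewrite g0// g'0.
apply/eqP; rewrite -subr_eq0; apply/eqP/dot_eq0.
have Vd : V (g' y - g y) by apply: VB; [exact: Vg' | exact: Vg].
by rewrite dotBr -gP// -g'P// subrr.
Qed.

End rank_one.

(** * Adjoints and traces in the orthonormal basis *)

Section nilpotent.
Variables (R : realType) (m : nat).
Local Notation C := R[i].
Variables (H : normedModType C) (dot : {dot H for Num.conj}).
Local Notation "''[' x , y ]" := (dot x y) : ring_scope.
Variables (T : 'I_m -> {linear H -> H}) (w : 'rV[C]_m) (e : 'I_(1 + m) -> H).
Hypothesis he : orthonormal_basis dot (second_ker T w) e.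
Variable alpha : 'I_m -> 'cV[C]_m.
Hypothesis halpha : forall k,
  is_matrix e (shift_op T w k) (block_mx 0 (alpha k)^T 0 0).
Local Notation f := (shift_op T w).
Local Notation N := (second_ker T w).
Local Notation e0 := (e ord0).
Local Notation e' := (fun l : 'I_m => e (rshift 1 l)).

Lemma shift_opD k x y : f k (x + y) = f k x + f k y.
Proof. by rewrite /shift_op linearD scalerDr opprD addrACA. Qed.

Lemma shift_opZ k a x : f k (a *: x) = a *: f k x.
Proof. by rewrite /shift_op linearZ/= scalerBr !scalerA mulrC. Qed.

Lemma shift_op0 k : f k 0 = 0.
Proof. by have := shift_opZ k 0 0; rewrite !scale0r. Qed.

Lemma shift_op_sum k (I : finType) (F : I -> H) : f k (\sum_i F i) = \sum_i f k (F i).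
Proof. exact: (big_morph _ (shift_opD k) (shift_op0 k)). Qed.

Lemma ord0_lshift : ord0 = lshift m ord0 :> 'I_(1 + m).
Proof. exact: val_inj. Qed.

Lemma shift_op_e0 k : f k e0 = 0.
Proof.
by rewrite halpha big1// => i _; rewrite ord0_lshift /block_mx; case: (split_ordP i) => l ->;
  rewrite ?col_mxEu ?col_mxEd row_mxEl mxE scale0r.
Qed.

Lemma shift_op_e k l : f k (e' l) = alpha k l 0 *: e0.
Proof.
rewrite halpha big_split_ord/= big_ord1 /block_mx col_mxEu row_mxEr mxE.
rewrite big1 ?addr0 => [|i _]; first by rewrite (_ : lshift m 0 = ord0)//; exact: val_inj.
by rewrite col_mxEd row_mxEr mxE scale0r.
Qed.

Lemma e0e0 : '[e0, e0] = 1.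
Proof. by rewrite he.2 eqxx. Qed.

Lemma coord_split x : N x -> exists a (b : 'I_m -> C), x = a *: e0 + \sum_l b l *: e' l.
Proof.
move=> /(basis_coord he.1)[c ->]; exists (c ord0), (fun l => c (rshift 1 l)).
rewrite big_split_ord/= big_ord1; congr (_ *: _ + _).
  by rewrite (_ : lshift m 0 = ord0)//; exact: val_inj.
by rewrite (_ : lshift m 0 = ord0)//; exact: val_inj.
Qed.

Lemma second_ker_sub x y : N x -> N y -> N (x - y).
Proof.
move=> Nx Ny i j; have fB k a b : f k (a - b) = f k a - f k b.
  by rewrite shift_opD -scaleN1r shift_opZ scaleN1r.
by rewrite (fB j x y) (fB i (f j x) (f j y)) Nx Ny subrr.
Qed.

Lemma second_ker_scale a x : N x -> N (a *: x).
Proof. by move=> Nx i j; rewrite !shift_opZ Nx scaler0. Qed.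

Lemma e'e0 l : '[e' l, e0] = 0.
Proof. by rewrite he.2. Qed.

Lemma e0e' l : '[e0, e' l] = 0.
Proof. by rewrite he.2. Qed.

Lemma e'e' l k : '[e' l, e' k] = (l == k)%:R.
Proof. by rewrite he.2 (inj_eq (@rshift_inj _ _)). Qed.

(** The image of [e0] under the adjoint of [f j]. *)
Definition adj_vect j : H := \sum_l (alpha j l 0)^* *: e' l.

Lemma adj_vect_mem j : N (adj_vect j).
Proof.
have := basis_mem (fun i : 'I_(1 + m) =>
  match fintype.split i with inl _ => 0 | inr l => (alpha j l 0)^* end) he.1.
rewrite big_split_ord/= big_ord1 (unsplitK (inl _ : 'I_1 + 'I_m)) scale0r add0r.
by under eq_bigr do rewrite (unsplitK (inr _ : 'I_1 + 'I_m)).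
Qed.

(** On the second kernel [f j x] is ['[x, adj_vect j] *: e0], an operator of rank one; its adjoint
    exchanges the two vectors. *)
Lemma adjoint_shift_op j y : N y ->
  adjoint_on dot N (f j) y = '[y, e0] *: adj_vect j.
Proof.
move=> Ny; rewrite (@adjoint_on_unique _ _ _ _ _
  (fun y => if `[< N y >] then '[y, e0] *: adj_vect j else 0)).
- by case: asboolP.
- exact: second_ker_sub.
- by move=> z Nz; case: asboolP => // _; apply: second_ker_scale; exact: adj_vect_mem.
- by move=> z Nz; case: asboolP.
move=> x z Nx Nz; case: asboolP => // _.
have [a [b ->]] := coord_split Nx.
have -> : f j (a *: e0 + \sum_l b l *: e' l) = (\sum_l b l * alpha j l 0) *: e0.
  rewrite shift_opD shift_opZ shift_op_e0 scaler0 add0r shift_op_sum scaler_suml.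
  by apply: eq_bigr => l _; rewrite shift_opZ shift_op_e scalerA.
have adjE l : '[e' l, adj_vect j] = alpha j l 0.
  rewrite dot_sumr (bigD1 l)//= big1 => [|k /negbTE lk].
    by rewrite dotZr e'e' eqxx mulr1 addr0 conjCK.
  by rewrite dotZr e'e' eq_sym lk mulr0.
have e0adj : '[e0, adj_vect j] = 0.
  by rewrite /adj_vect dot_sumr big1// => l _; rewrite dotZr e0e' mulr0.
rewrite dotZl (dotZr dot _ (adj_vect j)) dotDl dotZl e0adj.
rewrite mulr0 add0r dot_suml -dotC mulrC; congr (_ * _).
by apply: eq_bigr => l _; rewrite dotZl adjE.
Qed.

Lemma trace_shift_adjoint k j :
  trace_on N (f k \o adjoint_on dot N (f j)) = \sum_l alpha k l 0 * (alpha j l 0)^*.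
Proof.
apply: (trace_on_rank_one he.1) e0e0 _; first exact: basis_vect_mem he.1.
have fadj : f k (adj_vect j) = (\sum_l alpha k l 0 * (alpha j l 0)^*) *: e0.
  rewrite /adj_vect shift_op_sum scaler_suml.
  by apply: eq_bigr => l _; rewrite shift_opZ shift_op_e scalerA mulrC.
by move=> y Ny /=; rewrite adjoint_shift_op// shift_opZ fadj scalerA mulrC.
Qed.

End nilpotent.

(** * The curvature as a Gram matrix, and its inverse *)

Theorem mainTheorem2 (R : realType) (m : nat) (hm : (1 <= m)%N)
    (H : completeNormedModType R[i]) (dot : {dot H for Num.conj})
    (hdot : forall x : H, `|x| ^+ 2 = dot x x)
    (Omega : set 'rV[R[i]]_m) (hOmega : bounded_domain Omega)
    (T : 'I_m -> {linear H -> H}) (hT : B1 Omega T)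
    (gamma : 'rV[R[i]]_m -> H) (hol : holomorphic_on Omega gamma)
    (gamma_neq0 : forall w, Omega w -> gamma w != 0)
    (gamma_ker : forall w, Omega w -> joint_ker T w (gamma w))
    (w : 'rV[R[i]]_m) (hw : Omega w)
    (e : 'I_(1 + m) -> H) (he : orthonormal_basis dot (second_ker T w) e)
    (he0 : exists c : R[i], e ord0 = c *: gamma w)
    (alpha : 'I_m -> 'cV[R[i]]_m)
    (halpha : forall k,
       is_matrix e (shift_op T w k) (block_mx 0 (alpha k)^T 0 0)) :
  let A : 'M[R[i]]_m := \matrix_(l, k) alpha k l 0 in
  let N := second_ker T w in
  let trNN : 'M[R[i]]_m := \matrix_(k, j)
    trace_on N (shift_op T w k \o adjoint_on dot N (shift_op T w j)) in
  [/\ - (curvature gamma w)^T \in unitmx,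
      invmx (- (curvature gamma w)^T) = trNN &
      trNN = A^T *m map_mx Num.conj A].
Proof.
move=> A N trNN.
have trE : trNN = A^T *m map_mx Num.conj A.
  apply/matrixP => k j; rewrite !mxE (trace_shift_adjoint he halpha).
  by apply: eq_bigr => l _; rewrite !mxE.
have [oOmega _ _ _] := hOmega; have [c ec] := he0.
set e0 := e ord0 in ec; pose e' (l : 'I_m) := e (rshift 1 l).
pose D k := 'D_(delta_mx 0 k) gamma w.
have shD j k : shift_op T w j (D k) = (j == k)%:R *: gamma w.
  exact: (shift_op_derive oOmega hol _ (B1_bounded hT j) gamma_ker hw).
have ND k : N (D k).
  by move=> i j; rewrite shD shift_opZ (gamma_ker _ hw) scaler0.
have exab k : exists ab : R[i] * ('I_m -> R[i]), D k = ab.1 *: e0 + \sum_l ab.2 l *: e' l.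
  by have [a [b ->]] := coord_split he (ND k); exists (a, b).
have [ab Dab] := choice exab.
pose B : 'M[R[i]]_m := \matrix_(l, k) (ab k).2 l.
have e00 : dot e0 e0 = 1 by exact: e0e0 he.
have e0n : e0 != 0 by apply: contra_eqN e00 => /eqP ->; rewrite linear0r eq_sym oner_eq0.
have c0 : c != 0 by apply: contraNneq e0n => c0; rewrite ec c0 scale0r.
have gE : gamma w = c^-1 *: e0 by rewrite ec scalerA mulVf// scale1r.
(* Compare the coefficients of [e0] in [shift_op T w j (D k)], computed from the coordinates of
   [D k] and from [shD]. *)
have AB : A^T *m B = (c^-1)%:M.
  apply/matrixP => j k; rewrite !mxE.
  have : shift_op T w j (D k) = (\sum_l (ab k).2 l * alpha j l 0) *: e0.
    rewrite Dab shift_opD shift_opZ (shift_op_e0 halpha) scaler0 add0r shift_op_sum scaler_suml.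
    by apply: eq_bigr => l _; rewrite shift_opZ (shift_op_e halpha) scalerA.
  rewrite shD gE scalerA => /eqP; rewrite -subr_eq0 -scalerBl scaler_eq0 (negbTE e0n) orbF.
  rewrite subr_eq0 => /eqP E; rewrite -mulr_natl E.
  by apply: eq_bigr => l _; rewrite !mxE mulrC.
pose n : R[i] := (sqn dot gamma w)%:C.
(* This is the normalization of [e0 = c *: gamma w]. *)
have nE : c * c^* * n = 1.
  have <- : dot (gamma w) (gamma w) = n by rewrite /n /sqn dot_modulus.
  by rewrite -mulrA -(dotZr dot) -(dotZl dot) -ec.
(* Since [n] is the inverse of [c * c^*], the subtracted product in [curvatureE] cancels the
   [e0]-components in ['[D j, D i]], leaving the coordinates along [e']. *)
have KE : - (curvature gamma w)^T = (c * c^*) *: ((map_mx Num.conj B)^T *m B).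
  apply/matrixP => i j; rewrite !mxE -[X in X = _](_ : - curvature gamma w j i = _); last first.
    by rewrite !mxE.
  rewrite (curvatureE hdot oOmega hol _ _ gamma_neq0 hw) -/n -/(D i) -/(D j).
  have De0 k : dot (D k) e0 = (ab k).1.
    rewrite Dab dotDl dotZl e00 mulr1 dot_suml big1 ?addr0// => l _.
    by rewrite dotZl (e'e0 he) mulr0.
  have De' k l : dot (D k) (e' l) = (ab k).2 l.
    rewrite Dab dotDl dotZl (e0e' he) mulr0 add0r dot_suml (bigD1 l)//= big1 => [|q /negbTE ql].
      by rewrite dotZl (e'e' he) eqxx mulr1 addr0.
    by rewrite dotZl (e'e' he) ql mulr0.
  have DD k q : dot (D k) (D q) = (ab k).1 * ((ab q).1)^* + \sum_l (ab k).2 l * ((ab q).2 l)^*.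
    rewrite {1}Dab dotDl dotZl; congr (_ * _ + _); first by rewrite dotC De0.
    by rewrite dot_suml; apply: eq_bigr => l _; rewrite dotZl dotC De'.
  have Dg k : dot (D k) (gamma w) = (c^*)^-1 * (ab k).1.
    by rewrite gE (dotZr dot) fmorphV De0.
  have gD k : dot (gamma w) (D k) = c^-1 * ((ab k).1)^*.
    by rewrite gE (dotZl dot) dotC De0.
  have -> : \sum_l (map_mx Num.conj B)^T i l * B l j = \sum_l (ab j).2 l * ((ab i).2 l)^*.
    by apply: eq_bigr => l _; rewrite !mxE mulrC.
  have cc0 : c^* != 0 by rewrite conjC_eq0.
  have nV : n = (c * c^*)^-1.
    by apply: (mulfI (_ : c * c^* != 0)); rewrite ?mulf_neq0// nE mulfV// mulf_neq0.
  move: (DD j i) (Dg j) (gD i); clear -c0 cc0 nV; clearbody D n => -> -> ->.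
  move: cc0 nV; move: (c^*) (((ab i).1)^*) (ab j).1 (\sum_l _) => d x y S d0 ->.
  by rewrite invrK; field; rewrite c0 d0.
(* For square matrices the one-sided inverse given by [AB] is two-sided. *)
have BA : B *m A^T = (c^-1)%:M.
  have : (c *: A^T) *m B = 1%:M by rewrite -scalemxAl AB scale_scalar_mx mulfV.
  move=> /mulmx1C; rewrite -scalemxAr => /(congr1 ( *:%R c^-1)).
  by rewrite scalerA mulVf// scale1r scale_scalar_mx mulr1.
have CB : (map_mx Num.conj B)^T *m map_mx Num.conj A = ((c^-1)^*)%:M.
  rewrite map_trmx -map_mxM; have -> : B^T *m A = (c^-1)%:M.
    by rewrite -[A]trmxK -trmx_mul AB tr_scalar_mx.
  exact: map_scalar_mx.
have KG : - (curvature gamma w)^T *m trNN = 1%:M.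
  rewrite KE trE -scalemxAl mulmxA -(mulmxA _ B) BA mul_mx_scalar -scalemxAl CB.
  rewrite !scale_scalar_mx; congr (_%:M).
  by rewrite fmorphV (mulrC c) -!mulrA (mulVKf c0) mulfV// conjC_eq0.
have [uK _] := mulmx1_unit KG.
split => //.
by rewrite -[RHS]mul1mx -(mulVmx uK) -mulmxA KG mulmx1.
Qed.
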